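(* Let $\mathcal X=\mathbb R^d$ and fix $\alpha,\beta\in(0,1)$ with $\alpha+\beta<1$. Let $0<c\le C<\infty$ and $\theta=(d,\tau,M,s,L)\in\mathbb N_+\times\mathbb R_{\ge1}\times\mathbb R_+^3$, and suppose that $s\in\mathbb N_+$. There exists $c_1=c_1(c,C,\theta,\alpha,\beta)>0$ such that for all $r:\mathcal X\to\mathbb R_+$ satisfying $0<c\le r(\cdot)\le C$, and all sample sizes $n,m$ with $m\le n\le\tau m$, $$\rho_r^*(n,m,\theta,\alpha,\beta)\ge c_1\,n^{-2s/(4s+d)}.$$
   Context: $\mathbb R_+=(0,\infty)$, $\mathbb R_{\ge1}=[1,\infty)$, $\mathbb N_+=\{1,2,\ldots\}$. Densities are with respect to Lebesgue measure on $\mathbb R^d$. For densities $f,g$, let $P_f,P_g$ be the corresponding distributions, and let the data be $(X_1,\ldots,X_n,Y_1,\ldots,Y_m)\sim P:=P_f^{\otimes n}\otimes P_g^{\otimes m}$. The null hypothesis is $H_0:g\propto rf$, i.e. $g=rf/\int rf$. Let $\lambda_0>0$ be the unique constant such that $h:=(nf+mg)/(n+\lambda_0 m r)$ satisfies $\int h=1$, and set $\psi_r:=\frac{n+m}{m}(f-h)$. Sobolev ball: $\mathcal S_d^s(L):=\{p\in L^1(\mathbb R^d)\cap L^2(\mathbb R^d):\int_{\mathbb R^d}\|\xi\|_2^{2s}|\hat p(\xi)|^2\,d\xi\le(2\pi)^dL^2\}$, with $\hat p(\xi)=\int p(x)e^{-i\langle x,\xi\rangle}dx$. Alternatives: for $\rho>0$,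 $\mathcal S_\theta^r(\rho):=\{(f,g):\max(\|f\|_\infty,\|g\|_\infty)\le M,\ \|\psi_r\|_2>\rho,\ \psi_r\in\mathcal S_d^s(L)\}$. Tests: $\Psi(\alpha)$ is the set of randomized tests, i.e. measurable functions $\varphi:(\mathbb R^d)^{n+m}\to[0,1]$ of the data (the null is rejected with probability $\varphi$), that have size $\alpha$, meaning $\sup_{(f,g):g\propto rf}\mathbb E_P\varphi\le\alpha$. Minimax separation: $\rho_r^*(n,m,\theta,\alpha,\beta):=\inf\{\rho>0:\inf_{\varphi\in\Psi(\alpha)}\sup_{(f,g)\in\mathcal S_\theta^r(\rho)}\mathbb E_P(1-\varphi)\le\beta\}$. *)

(* Defs.v *)
From HB Require Import structures.
From mathcomp Require Import all_boot all_order all_algebra complex.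
From mathcomp Require Import all_classical all_reals all_analysis.
From mathcomp Require Import measurable_realfun.

Set Implicit Arguments.
Unset Strict Implicit.
Unset Printing Implicit Defensive.

Import Order.TTheory GRing.Theory Num.Theory.
Import numFieldNormedType.Exports.

Local Open Scope classical_set_scope.
Local Open Scope ring_scope.

Section power_measure.
Context {d} {T : measurableType d} {R : realType}.
Local Open Scope ereal_scope.

Definition cons_pair n (p : T * n.-tuple T) : n.+1.-tuple T :=
  [tuple of p.1 :: p.2].

Lemma measurable_cons_pair n : measurable_fun setT (@cons_pair n).
Proof. exact: (measurable_cons measurable_fst measurable_snd). Qed.

Definition uncons_pair n (t : n.+1.-tuple T) : T * n.-tuple T :=
  (thead t, [tuple of behead t]).

Lemma measurable_uncons_pair n : measurable_fun setT (@uncons_pair n).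
Proof.
apply/measurable_fun_pairP; split => /=; last exact: measurable_behead.
exact: measurable_tnth.
Qed.

Lemma cons_pairK n : cancel (@cons_pair n) (@uncons_pair n).
Proof.
move=> [x t]; rewrite /uncons_pair /cons_pair /= theadE; congr pair.
exact: val_inj.
Qed.

(* The n-fold product measure, obtained by adding one coordinate at a time at
   the head of the tuple. *)
Fixpoint power_measure (mu : set T -> \bar R) (n : nat) :
    set (n.-tuple T) -> \bar R :=
  match n return set (n.-tuple T) -> \bar R with
  | 0%N => @dirac _ (0.-tuple T) [tuple] R
  | k.+1 => pushforward (mu \x @power_measure mu k) (@cons_pair k)
  end.

Arguments power_measure mu n _ : clear implicits.

Section sigma_finite.
Variable mu : {sigma_finite_measure set T -> \bar R}.

Section step.
Variables (n : nat) (m : {sigma_finite_measure set (n.-tuple T) -> \bar R}).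

Let mc := @measurable_cons_pair n.

Let step := pushforward (mu \x m) (@cons_pair n).

Let step0 : step set0 = 0. Proof. exact: measure0. Qed.

Let step_ge0 A : 0 <= step A. Proof. exact: measure_ge0. Qed.

Let step_semi_sigma_additive : semi_sigma_additive step.
Proof. exact: measure_semi_sigma_additive. Qed.

HB.instance Definition _ := isMeasure.Build _ _ _ step
  step0 step_ge0 step_semi_sigma_additive.

Let step_sigma_finite : sigma_finite setT step.
Proof.
have /sigma_finiteP[F [TF ndF Foo]] := sigma_finiteT mu.
have /sigma_finiteP[G [TG ndG Goo]] := sigma_finiteT m.
exists (fun k => @uncons_pair n @^-1` (F k `*` G k)).
  rewrite -preimage_bigcup (_ : \bigcup_i _ = setT) ?preimage_setT//.
  apply/seteqP; split=> // -[x t] _.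
  have [i _ Fix] : (\bigcup_i F i) x by rewrite -TF.
  have [j _ Gjt] : (\bigcup_i G i) t by rewrite -TG.
  exists (maxn i j) => //; split => /=.
    by move: x Fix; exact/subsetPset/ndF/leq_maxl.
  by move: t Gjt; exact/subsetPset/ndG/leq_maxr.
move=> k; have [mF Fk] := Foo k; have [mG Gk] := Goo k; split.
  rewrite -[X in measurable X]setTI; apply: measurable_uncons_pair => //.
  exact: measurableX.
rewrite /step /pushforward (_ : _ @^-1` _ = F k `*` G k); last first.
  rewrite -comp_preimage (_ : _ \o _ = id) ?preimage_id//.
  by apply/funext => p /=; rewrite cons_pairK.
by rewrite product_measure1E// lte_mul_pinfty// ge0_fin_numE.
Qed.

HB.instance Definition _ := Measure_isSigmaFinite.Build _ _ _ step
  step_sigma_finite.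

Lemma power_measure_step :
  exists m' : {sigma_finite_measure set (n.+1.-tuple T) -> \bar R},
  m' = pushforward (mu \x m) (@cons_pair n) :> (set _ -> \bar R).
Proof. by exists step. Qed.

End step.

Let power_measureP n :
  exists m : {sigma_finite_measure set (n.-tuple T) -> \bar R},
  m = power_measure mu n :> (set _ -> \bar R).
Proof.
elim: n => [|n [m mE]] /=; first by exists (@dirac _ (0.-tuple T) [tuple] R).
by rewrite -mE; exact: power_measure_step.
Qed.

Variable n : nat.

Let power_measure0 : power_measure mu n set0 = 0.
Proof. by have [m <-] := power_measureP n; exact: measure0. Qed.

Let power_measure_ge0 A : 0 <= power_measure mu n A.
Proof. by have [m <-] := power_measureP n; exact: measure_ge0. Qed.

Let power_measure_semi_sigma_additive :
  semi_sigma_additive (power_measure mu n).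
Proof.
by have [m <-] := power_measureP n; exact: measure_semi_sigma_additive.
Qed.

HB.instance Definition _ := isMeasure.Build _ _ _ (power_measure mu n)
  power_measure0 power_measure_ge0 power_measure_semi_sigma_additive.

Let power_measure_sigma_finite : sigma_finite setT (power_measure mu n).
Proof. by have [m <-] := power_measureP n; exact: sigma_finiteT. Qed.

HB.instance Definition _ := Measure_isSigmaFinite.Build _ _ _
  (power_measure mu n) power_measure_sigma_finite.

End sigma_finite.

Section probability.
Variables (P : probability T R) (n : nat).

Let power_measure_setT : power_measure P n setT = 1.
Proof.
elim: n => [|k ih] /=; first by rewrite diracT.
rewrite /pushforward preimage_setT -setXTT.
rewrite -[RHS]mule1 -{1}(probability_setT P) -ih.
exact: product_measure1E.
Qed.

HB.instance Definition _ := Measure_isProbability.Build _ _ _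
  (power_measure P n) power_measure_setT.

End probability.
End power_measure.
Arguments power_measure {d T R} mu n _.

Section lebesgue.
Context {R : realType} {d : nat}.

Definition euclidean : Type := d.-tuple (measurableTypeR R).

HB.instance Definition _ := Measurable.on euclidean.

Definition lebesgue : set euclidean -> \bar R :=
  power_measure (@lebesgue_measure R) d.

HB.instance Definition _ := SigmaFiniteMeasure.on lebesgue.

Definition dotv (x y : euclidean) : R :=
  \sum_(i < d) (tnth x i : R) * (tnth y i : R).

Definition norm2 (x : euclidean) : R := Num.sqrt (dotv x x).

End lebesgue.
Arguments euclidean : clear implicits.

Section density.
Context {R : realType} {d : nat}.

Record density := Density {
  density_fun :> euclidean R d -> R;
  measurable_density : measurable_fun setT density_fun;
  density_ge0 : forall x, 0 <= density_fun x;
  integral_density : (\int[lebesgue]_x (density_fun x)%:E = 1)%E }.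

Variable f : density.

Definition density_prob (A : set (euclidean R d)) : \bar R :=
  (\int[lebesgue]_(x in A) (f x)%:E)%E.

Let density_prob0 : density_prob set0 = 0%E.
Proof. by rewrite /density_prob integral_set0. Qed.

Let density_prob_ge0 A : (0 <= density_prob A)%E.
Proof. by apply: integral_ge0 => x _; rewrite lee_fin density_ge0. Qed.

Let density_prob_sigma_additive : semi_sigma_additive density_prob.
Proof.
move=> F mF tF mUF; rewrite /density_prob; apply: cvg_toP.
  apply: ereal_nondecreasing_is_cvgn => m n mn.
  apply: lee_sum_nneg_natr => // k _ _; exact: density_prob_ge0.
rewrite ge0_integral_bigcup//.
- apply: measurable_funTS; apply: measurableT_comp => //.
  exact: measurable_density.
- by move=> x _; rewrite lee_fin density_ge0.
Qed.

HB.instance Definition _ := isMeasure.Build _ _ _ density_prob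
  density_prob0 density_prob_ge0 density_prob_sigma_additive.

Let density_prob_setT : density_prob setT = 1%E.
Proof. exact: integral_density. Qed.

HB.instance Definition _ := Measure_isProbability.Build _ _ _
  density_prob density_prob_setT.

End density.
Arguments density : clear implicits.

Section sobolev.
Context {R : realType} {d : nat}.
Local Notation X := (euclidean R d).

Definition Cintegral (F : X -> R[i]) : R[i] :=
  Complex (\int[lebesgue]_x complex.Re (F x)) (\int[lebesgue]_x complex.Im (F x)).

(* e^{-i t} *)
Definition expNi (t : R) : R[i] := Complex (cos t) (- sin t).

Definition fourier (p : X -> R) (xi : X) : R[i] :=
  Cintegral (fun x => (p x)%:C%C * expNi (dotv x xi)).

Definition sobolev_ball (s L : R) : set (X -> R) :=
  [set p | [/\ p \in Lfun lebesgue 1, p \in Lfun lebesgue 2%:E &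
    (\int[lebesgue]_xi (norm2 xi `^ (2 * s) * Normc.normc (fourier p xi) ^+ 2)%:E
      <= ((2 * pi) ^+ d * L ^+ 2)%:E)%E]].

End sobolev.

Section testing.
Context {R : realType} {d : nat}.
Local Notation X := (euclidean R d).
Implicit Types (r : X -> R) (f g : density R d) (n m : nat).

Local Notation data n m := (n.-tuple X * m.-tuple X)%type.

Definition data_law f g n m : probability (data n m) R :=
  (power_measure (density_prob f) n \x power_measure (density_prob g) m)%E.

(* Densities are identified when they agree almost everywhere. *)
Definition null_hypothesis r : set (density R d * density R d) :=
  [set fg : density R d * density R d | {ae lebesgue, forall x,
    fg.2 x = r x * fg.1 x / \int[lebesgue]_y (r y * fg.1 y)}].

Definition pooled r f g n m (lambda : R) (x : X) : R :=
  (n%:R * f x + m%:R * g x) / (n%:R + lambda * m%:R * r x).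

(* Existence and uniqueness hold when r is measurable and bounded away from
   0 and +oo and n, m > 0; the default value 0 is then never used. *)
Definition lambda0 r f g n m : R :=
  xget 0 [set lambda | 0 < lambda /\
    (\int[lebesgue]_x (pooled r f g n m lambda x)%:E = 1)%E].

Definition psi r f g n m (x : X) : R :=
  (n + m)%:R / m%:R * (f x - pooled r f g n m (lambda0 r f g n m) x).

Definition alternatives r n m (M s L rho : R) :
    set (density R d * density R d) :=
  [set fg : density R d * density R d | [/\
    (Order.max 'N[lebesgue]_+oo[EFin \o fg.1] 'N[lebesgue]_+oo[EFin \o fg.2]
      <= M%:E)%E,
    (rho%:E < 'N[lebesgue]_2%:E[EFin \o psi r fg.1 fg.2 n m])%E &
    sobolev_ball s L (psi r fg.1 fg.2 n m)]].

Definition tests r n m (alpha : R) : set (data n m -> R) :=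
  [set phi : data n m -> R | [/\ measurable_fun setT phi, forall z, 0 <= phi z <= 1 &
    (ereal_sup [set 'E_(data_law fg.1 fg.2 n m)[phi] |
       fg in null_hypothesis r] <= alpha%:E)%E]].

Arguments tests r n m alpha _ : clear implicits.

(* Over an empty set of alternatives the supremum is -oo, so such a rho counts
   as achieving every error level, as with the convention that it is 0. *)
Definition worst_type2_error r n m (M s L rho : R) (phi : data n m -> R) :
    \bar R :=
  ereal_sup [set 'E_(data_law fg.1 fg.2 n m)[fun z => (1 - phi z)%R]%E |
    fg in alternatives r n m M s L rho].

Definition minimax_separation r n m (M s L alpha beta : R) : \bar R :=
  ereal_inf [set rho%:E | rho in [set rho : R | 0 < rho /\
    (ereal_inf [set worst_type2_error r M s L rho phi |
       phi in tests r n m alpha] <= beta%:E)%E]].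

End testing.

(* Main.v *)
(** Ingster's second moment method.  The null pair is [(h, lambda r h)] with [h]
    uniform on a cube of side [A] and [lambda] normalizing.  Cut the cube into [N^d] cells
    and put [psi_e = gamma * sum_k e_k phi_k], where [phi_k] is a product bump of mean zero in
    the [k]-th cell and [e] is a vector of signs.  The alternatives
      [f_e = h + m / (n + m) psi_e], [g_e = lambda r h - n / (n + m) psi_e]
    leave [n f + m g] unchanged, hence the pooled density is still [h], with the same
    [lambda], and [psi_r = psi_e].  Since the bumps have disjoint supports, the second
    moment of the averaged likelihood ratio is at most the average over [e], [e'] of
    [exp (sum_k e_k e'_k w_k)] with [w_k <= const * n gamma^2 N^-d], which is bounded as
    soon as [N^d (n gamma^2 N^-d)^2] is small.

    The Sobolev seminorm is bounded without Plancherel's theorem.  The Fourier transform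
    of [psi_e] is a trigonometric polynomial on a lattice times a tensor product of
    one-dimensional transforms, whose decay is majorized by a weight that is constant on
    the shells [j rho <= |x| < (j + 1) rho], with [rho] the period of the dual lattice.
    The characters of the lattice are orthogonal for such a weight, so the weighted
    integral is a multiple of the sum of the squared coefficients.

    The choice [N ~ n^(2 / (4 s + d))], [gamma ~ N^-s] balances the two constraints. *)
Require Import Defs.
From mathcomp Require Import all_boot all_order all_algebra complex.
From mathcomp Require Import all_classical all_reals all_analysis.
From mathcomp Require Import measurable_realfun ring lra.

Set Implicit Arguments.
Unset Strict Implicit.
Unset Printing Implicit Defensive.
Import Order.TTheory GRing.Theory Num.Theory.
Import numFieldNormedType.Exports.

Local Open Scope classical_set_scope.
Local Open Scope ring_scope.

(** * Integration on product spaces *)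

(** Smoothness is required of [psi_r] alone, so a merely measurable [r] can be absorbed into the
    null pair. After that it enters only through [c / C <= lambda r <= C / c], and perturbations
    bounded by [(c / C) h] keep [g_e] nonnegative. The rate comes from three scalings. The [N^d]
    cells of volume of order [N^-d] cancel in the L2 norm of [psi_e], so the separation is [gamma]
    up to a constant. Bumps of width of order [1 / N] have Sobolev seminorm of order [gamma N^s],
    which forces [gamma] to be at most of order [N^-s]. With this [gamma], the second moment
    condition [n^2 gamma^4 N^-d <= const] reads [n^2 <= const N^(4 s + d)], so the coarsest
    admissible grid gives the largest separation. Shells suit the characters because a nonconstant
    character of period [rho] has mean zero on every interval [[- j rho, j rho]], hence on every
    shell, which any weight constant on shells preserves. The bumps decay one order faster than the
    Sobolev weight grows, and this spare order is what the summable shell weight majorizes. *)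

Section power_measure_integral.
Context {d} {T : measurableType d} {R : realType}.
Variable mu : {sigma_finite_measure set T -> \bar R}.
Local Open Scope ereal_scope.

Lemma ge0_integral_power_measure_cons n (F : n.+1.-tuple T -> \bar R) :
  measurable_fun setT F -> (forall t, 0 <= F t) ->
  \int[power_measure mu n.+1]_t F t =
  \int[mu \x power_measure mu n]_z F (cons_pair z).
Proof.
move=> mF F0.
have mc := @measurable_cons_pair _ T n.
(* [power_measure] at a successor is this pushforward by conversion; writing it out exposes it to
   the change of variables. *)
transitivity (\int[pushforward (mu \x power_measure mu n) (@cons_pair _ T n)]_t F t).
  by [].
by rewrite ge0_integral_pushforward.
Qed.

Lemma ge0_integral_power_measureS n (F : n.+1.-tuple T -> \bar R) :
  measurable_fun setT F -> (forall t, 0 <= F t) ->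
  \int[power_measure mu n.+1]_t F t =
  \int[mu]_x \int[power_measure mu n]_t F [tuple of x :: t].
Proof.
move=> mF F0; rewrite ge0_integral_power_measure_cons// fubini_tonelli1//.
exact: (measurableT_comp mF (@measurable_cons_pair _ T n)).
Qed.

Lemma measurable_tnth_prod n (F : 'I_n -> T -> R) :
  (forall i, measurable_fun setT (F i)) ->
  measurable_fun setT (fun t : n.-tuple T => \prod_(i < n) F i (tnth t i))%R.
Proof.
move=> mF; apply: measurable_prod => i _; apply: (measurableT_comp (mF i)).
exact: measurable_tnth.
Qed.

Lemma ge0_integral_power_measure_prod n (F : 'I_n -> T -> R) :
  (forall i, measurable_fun setT (F i)) -> (forall i x, 0 <= F i x)%R ->
  \int[power_measure mu n]_t (\prod_(i < n) F i (tnth t i))%:E =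
  \prod_(i < n) \int[mu]_x (F i x)%:E.
Proof.
elim: n F => [F mF F0|n ih F mF F0].
  under eq_integral do rewrite big_ord0.
  by rewrite big_ord0 /= integral_dirac// diracT mul1e.
rewrite ge0_integral_power_measureS//; last 2 first.
- by apply/measurable_EFinP; exact: measurable_tnth_prod.
- by move=> t; rewrite lee_fin prodr_ge0.
rewrite big_ord_recl.
have mt : measurable_fun setT (fun t : n.-tuple T =>
    (\prod_(i < n) F (lift ord0 i) (tnth t i))%:E).
  by apply/measurable_EFinP; exact: (@measurable_tnth_prod _ (fun i => F (lift ord0 i))).
transitivity (\int[mu]_x ((F ord0 x)%:E *
    \int[power_measure mu n]_t (\prod_(i < n) F (lift ord0 i) (tnth t i))%:E)).
  apply: eq_integral => x _.
  rewrite -ge0_integralZl//; last 2 first.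
  - by move=> t _; rewrite lee_fin prodr_ge0.
  - by rewrite lee_fin.
  apply: eq_integral => t _.
  rewrite big_ord_recl EFinM tnth0; congr (_ * (_)%:E).
  by apply: eq_bigr => i _; rewrite tnthS.
rewrite ge0_integralZr//; first by congr (_ * _); exact: (ih (fun i => F (lift ord0 i))).
- exact/measurable_EFinP.
- by move=> x _; rewrite lee_fin.
- by apply: integral_ge0 => t _; rewrite lee_fin prodr_ge0.
Qed.

End power_measure_integral.

Section product_integral.
Context d1 d2 (T1 : measurableType d1) (T2 : measurableType d2) (R : realType).
Variable m1 : {sigma_finite_measure set T1 -> \bar R}.
Variable m2 : {sigma_finite_measure set T2 -> \bar R}.
Variables (f : T1 -> R) (g : T2 -> R).
Hypothesis (intf : m1.-integrable setT (EFin \o f)).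
Hypothesis (intg : m2.-integrable setT (EFin \o g)).

Lemma integrable_tensor :
  (m1 \x m2)%E.-integrable setT (EFin \o (fun z : T1 * T2 => f z.1 * g z.2)).
Proof.
have /integrableP[mf foo] := intf.
have /integrableP[mg goo] := intg.
have mfg : measurable_fun setT (EFin \o (fun z : T1 * T2 => f z.1 * g z.2)).
  apply/measurable_EFinP; apply: measurable_funM.
    by apply: (measurableT_comp (f := f)) => //; exact/measurable_EFinP.
  by apply: (measurableT_comp (f := g)) => //; exact/measurable_EFinP.
apply/integrable12ltyP => //.
rewrite (_ : (\int[m1]_x _)%E =
   ((\int[m1]_x `|(f x)%:E|) * (\int[m2]_y `|(g y)%:E|))%E).
  by rewrite lte_mul_pinfty ?integral_ge0// ge0_fin_numE// integral_ge0.
rewrite -ge0_integralZr//; last 2 first.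
- exact: measurableT_comp.
- exact: integral_ge0.
apply: eq_integral => x _; rewrite -ge0_integralZl//; last exact: measurableT_comp.
by apply: eq_integral => y _; rewrite /= normrM EFinM.
Qed.

Lemma Rintegral_tensor :
  \int[(m1 \x m2)%E]_z (f z.1 * g z.2) = (\int[m1]_x f x) * (\int[m2]_y g y).
Proof.
rewrite /Rintegral -(integral12_prod_meas1 integrable_tensor) /fubini_F /=.
have fing := integrable_fin_num measurableT intg.
have finf := integrable_fin_num measurableT intf.
rewrite -fineM// -[X in fine X = _]/(\int[m1]_x \int[m2]_y (f x * g y)%:E)%E; congr fine.
rewrite -(fineK fing) -integralZr//; apply: eq_integral => x _.
by rewrite (fineK fing) -integralZl.
Qed.

End product_integral.

(** * Complex-valued integrals *)

Section complex_integral.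
Context {d} {T : measurableType d} {R : realType}.
Implicit Types (mu : {measure set T -> \bar R}) (F G : T -> R[i]).

(** The same formula as [Cintegral] but for any measure: factorizing a Fourier transform over
    coordinates involves the measure on the line and all its powers. *)
Definition cintegral mu F : R[i] :=
  Complex (\int[mu]_x complex.Re (F x)) (\int[mu]_x complex.Im (F x)).

Definition cintegrable mu F :=
  mu.-integrable setT (EFin \o (fun x => complex.Re (F x))) /\
  mu.-integrable setT (EFin \o (fun x => complex.Im (F x))).

Lemma EFin_integrableZl mu (a : R) (f : T -> R) :
  mu.-integrable setT (EFin \o f) ->
  mu.-integrable setT (EFin \o (fun x => a * f x)).
Proof.
move=> intf; rewrite (_ : _ \o _ = (fun x => a%:E * (EFin \o f) x)%E)//.
exact: integrableZl.
Qed.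

Lemma EFin_integrableD mu (f g : T -> R) :
  mu.-integrable setT (EFin \o f) -> mu.-integrable setT (EFin \o g) ->
  mu.-integrable setT (EFin \o (fun x => f x + g x)).
Proof.
move=> intf intg.
rewrite (_ : _ \o _ = (EFin \o f) \+ (EFin \o g))%E//.
exact: integrableD.
Qed.

Lemma EFin_integrableB mu (f g : T -> R) :
  mu.-integrable setT (EFin \o f) -> mu.-integrable setT (EFin \o g) ->
  mu.-integrable setT (EFin \o (fun x => f x - g x)).
Proof.
move=> intf intg.
rewrite (_ : _ \o _ = (EFin \o f) \- (EFin \o g))%E//.
exact: integrableB.
Qed.

Lemma cintegrableZl mu (k : R[i]) F : cintegrable mu F ->
  cintegrable mu (fun x => k * F x).
Proof.
case: k => a b [ReF ImF]; split.
- rewrite (_ : (fun x => _) = (fun x =>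
      a * complex.Re (F x) - b * complex.Im (F x))).
    by apply: EFin_integrableB => //; exact: EFin_integrableZl.
  by apply/funext => x /=; case: (F x).
- rewrite (_ : (fun x => _) = (fun x =>
      a * complex.Im (F x) + b * complex.Re (F x))).
    by apply: EFin_integrableD => //; exact: EFin_integrableZl.
  by apply/funext => x /=; case: (F x).
Qed.

Lemma cintegralZl mu (k : R[i]) F : cintegrable mu F ->
  cintegral mu (fun x => k * F x) = k * cintegral mu F.
Proof.
case: k => a b [ReF ImF]; apply/eqP; rewrite /cintegral eq_complex /=.
rewrite -!RintegralZl// -RintegralB//; [|exact: EFin_integrableZl..].
rewrite -RintegralD//; [|exact: EFin_integrableZl..].
by apply/andP; split; apply/eqP/eq_Rintegral => x _; case: (F x).
Qed.

Lemma cintegrableD mu F G : cintegrable mu F -> cintegrable mu G ->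
  cintegrable mu (fun x => F x + G x).
Proof.
move=> [ReF ImF] [ReG ImG]; split.
- rewrite (_ : (fun x => _) = (fun x => complex.Re (F x) + complex.Re (G x))).
    exact: EFin_integrableD.
  by apply/funext => x /=; case: (F x); case: (G x).
- rewrite (_ : (fun x => _) = (fun x => complex.Im (F x) + complex.Im (G x))).
    exact: EFin_integrableD.
  by apply/funext => x /=; case: (F x); case: (G x).
Qed.

Lemma cintegralD mu F G : cintegrable mu F -> cintegrable mu G ->
  cintegral mu (fun x => F x + G x) = cintegral mu F + cintegral mu G.
Proof.
move=> [ReF ImF] [ReG ImG]; apply/eqP; rewrite /cintegral eq_complex /=.
rewrite -!RintegralD//.
by apply/andP; split; apply/eqP/eq_Rintegral => x _; case: (F x); case: (G x).
Qed.

Lemma cintegrable0 mu : cintegrable mu (fun=> 0).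
Proof. by split; exact: integrable0. Qed.

Lemma cintegral0 mu : cintegral mu (fun=> 0) = 0.
Proof. by rewrite /cintegral /Rintegral /= !integral0. Qed.

Lemma cintegrable_sum mu (I : Type) (r : seq I) (F : I -> T -> R[i]) :
  (forall i, cintegrable mu (F i)) ->
  cintegrable mu (fun x => \sum_(i <- r) F i x).
Proof.
move=> iF; elim: r => [|i r ih].
  by under eq_fun do rewrite big_nil; exact: cintegrable0.
by under eq_fun do rewrite big_cons; exact: cintegrableD.
Qed.

Lemma cintegral_sum mu (I : Type) (r : seq I) (F : I -> T -> R[i]) :
  (forall i, cintegrable mu (F i)) ->
  cintegral mu (fun x => \sum_(i <- r) F i x) =
  \sum_(i <- r) cintegral mu (F i).
Proof.
move=> iF; elim: r => [|i r ih].
  by rewrite big_nil; under eq_fun do rewrite big_nil; exact: cintegral0.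
rewrite big_cons -ih; under eq_fun do rewrite big_cons.
by rewrite cintegralD//; exact: cintegrable_sum.
Qed.

End complex_integral.

Section complex_power_measure.
Context {d} {T : measurableType d} {R : realType}.
Variable mu : {sigma_finite_measure set T -> \bar R}.

(** Fubini for tensor products of complex functions. The real and imaginary parts of
    [F ord0 x * V t] are each a combination of two real tensors, which reduces the induction step to
    four uses of [Rintegral_tensor]. Integrability belongs to the conclusion because the induction
    consumes it. *)
Lemma cintegral_power_measure_prod n (F : 'I_n -> T -> R[i]) :
  (forall i, cintegrable mu (F i)) ->
  let FT := fun t : n.-tuple T => \prod_(i < n) F i (tnth t i) in
  cintegrable (power_measure mu n) FT /\
  cintegral (power_measure mu n) FT = \prod_(i < n) cintegral mu (F i).
Proof.
elim: n F => [F iF /=|n ih F iF /=].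
  have ic (a : R) : (power_measure mu 0).-integrable setT (EFin \o cst a).
    exact: (@finite_measure_integrable_cst _ _ _ (dirac [tuple])).
  split.
    split.
      by rewrite (_ : _ \o _ = EFin \o cst 1)//; apply/funext => t /=; rewrite big_ord0.
    by rewrite (_ : _ \o _ = EFin \o cst 0)//; apply/funext => t /=; rewrite big_ord0.
  rewrite big_ord0 /cintegral.
  rewrite [X in Complex X _](_ : _ = 1) 1?[X in Complex _ X](_ : _ = 0)//.
    by rewrite /Rintegral; under eq_integral do rewrite big_ord0; rewrite integral0.
  rewrite /Rintegral; under eq_integral do rewrite big_ord0.
  by rewrite /= integral_dirac// diracT mul1e.
pose V := fun t : n.-tuple T => \prod_(i < n) F (lift ord0 i) (tnth t i).
have [[ReV ImV] VE] := ih (fun i => F (lift ord0 i)) (fun i => iF _).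
rewrite -/V in ReV ImV VE.
pose FT := fun t : n.+1.-tuple T => \prod_(i < n.+1) F i (tnth t i).
have FE (x : T) (t : n.-tuple T) : FT [tuple of x :: t] = F ord0 x * V t.
  rewrite /FT big_ord_recl tnth0; congr *%R.
  by apply: eq_bigr => i _; rewrite tnthS.
have [ReF ImF] := iF ord0.
pose F0V := fun z : T * n.-tuple T => F ord0 z.1 * V z.2.
have FTE z : FT (cons_pair z) = F0V z by case: z => x t; exact: FE.
have ReE : (fun z => complex.Re (F0V z)) = (fun z =>
    complex.Re (F ord0 z.1) * complex.Re (V z.2) -
    complex.Im (F ord0 z.1) * complex.Im (V z.2)).
  by apply/funext => z; rewrite /F0V; case: (F ord0 z.1); case: (V z.2).
have ImE : (fun z => complex.Im (F0V z)) = (fun z =>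
    complex.Re (F ord0 z.1) * complex.Im (V z.2) +
    complex.Im (F ord0 z.1) * complex.Re (V z.2)).
  by apply/funext => z; rewrite /F0V; case: (F ord0 z.1); case: (V z.2).
have mc := @measurable_cons_pair _ T n.
have iRR := integrable_tensor (m2 := power_measure mu n) ReF ReV.
have iII := integrable_tensor (m2 := power_measure mu n) ImF ImV.
have iRI := integrable_tensor (m2 := power_measure mu n) ReF ImV.
have iIR := integrable_tensor (m2 := power_measure mu n) ImF ReV.
have iF0V : cintegrable (mu \x power_measure mu n)%E F0V.
  split; rewrite ?ReE ?ImE.
  - exact: (EFin_integrableB iRR iII).
  - exact: (EFin_integrableD iRI iIR).
have FTuncons t : FT t = F0V (uncons_pair t).
  by rewrite -FTE; congr FT; rewrite /cons_pair /uncons_pair /=; exact: tuple_eta.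
have [iRe iIm] := iF0V.
(* The pushforward rules ask for measurability of [FT] itself, which is obtained by factoring it
   through [uncons_pair]. *)
have mRe : measurable_fun setT (EFin \o (fun t => complex.Re (FT t))).
  rewrite (_ : _ \o _ = (EFin \o (fun z => complex.Re (F0V z))) \o @uncons_pair _ _ n).
    apply: measurableT_comp; last exact: measurable_uncons_pair.
    exact: measurable_int iRe.
  by apply/funext => t /=; rewrite FTuncons.
have mIm : measurable_fun setT (EFin \o (fun t => complex.Im (FT t))).
  rewrite (_ : _ \o _ = (EFin \o (fun z => complex.Im (F0V z))) \o @uncons_pair _ _ n).
    apply: measurableT_comp; last exact: measurable_uncons_pair.
    exact: measurable_int iIm.
  by apply/funext => t /=; rewrite FTuncons.
have FTRe : (EFin \o (fun t => complex.Re (FT t))) \o @cons_pair _ T n =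
    EFin \o (fun z => complex.Re (F0V z)).
  by apply/funext => z /=; rewrite FTE.
have FTIm : (EFin \o (fun t => complex.Im (FT t))) \o @cons_pair _ T n =
    EFin \o (fun z => complex.Im (F0V z)).
  by apply/funext => z /=; rewrite FTE.
have piRe : (mu \x power_measure mu n)%E.-integrable (@cons_pair _ T n @^-1` setT)
    ((EFin \o (fun t => complex.Re (FT t))) \o @cons_pair _ T n).
  by rewrite preimage_setT FTRe.
have piIm : (mu \x power_measure mu n)%E.-integrable (@cons_pair _ T n @^-1` setT)
    ((EFin \o (fun t => complex.Im (FT t))) \o @cons_pair _ T n).
  by rewrite preimage_setT FTIm.
split.
  split.
  - exact: (integrable_pushforward mc mRe piRe measurableT).
  - exact: (integrable_pushforward mc mIm piIm measurableT).
rewrite big_ord_recl -VE /cintegral /Rintegral.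
rewrite (integral_pushforward mc mRe piRe measurableT).
rewrite (integral_pushforward mc mIm piIm measurableT).
rewrite preimage_setT FTRe FTIm -!/(Rintegral _ _ _) ReE ImE.
rewrite (RintegralB measurableT iRR iII) (RintegralD measurableT iRI iIR).
rewrite (Rintegral_tensor (m2 := power_measure mu n) ReF ReV).
rewrite (Rintegral_tensor (m2 := power_measure mu n) ImF ImV).
rewrite (Rintegral_tensor (m2 := power_measure mu n) ReF ImV).
by rewrite (Rintegral_tensor (m2 := power_measure mu n) ImF ReV).
Qed.

End complex_power_measure.

(** * The second moment method *)

(** Phrased with integrals of nonnegative functions rather than measures of sets, so that it passes
    to product measures by Tonelli's theorem alone. *)
Definition has_density {d} {T : measurableType d} {R : realType}
    (Q P : {measure set T -> \bar R}) (u : T -> R) :=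
  [/\ measurable_fun setT u, forall x, 0 <= u x &
    forall F : T -> \bar R, measurable_fun setT F -> (forall x, (0 <= F x)%E) ->
    (\int[Q]_x F x = \int[P]_x (F x * (u x)%:E))%E].

Section has_density.
Context {R : realType}.
Local Open Scope ereal_scope.

Lemma has_density_prod d1 d2 (T1 : measurableType d1) (T2 : measurableType d2)
    (Q1 P1 : {sigma_finite_measure set T1 -> \bar R})
    (Q2 P2 : {sigma_finite_measure set T2 -> \bar R}) (u : T1 -> R) (v : T2 -> R) :
  has_density Q1 P1 u -> has_density Q2 P2 v ->
  has_density (Q1 \x Q2) (P1 \x P2) (fun z => u z.1 * v z.2)%R.
Proof.
move=> [mu u0 uE] [mv v0 vE].
have muv : measurable_fun setT (fun z : T1 * T2 => u z.1 * v z.2)%R.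
  apply: measurable_funM; first exact: (measurableT_comp mu measurable_fst).
  exact: (measurableT_comp mv measurable_snd).
split=> // [z|F mF F0]; first exact: mulr_ge0.
rewrite fubini_tonelli1//= fubini_tonelli1//=; last 2 first.
- by apply: emeasurable_funM => //; exact/measurable_EFinP.
- by move=> z; rewrite mule_ge0// lee_fin mulr_ge0.
rewrite uE; last 2 first.
- exact: measurable_fun_fubini_tonelli_F.
- by move=> x; exact: integral_ge0.
apply: eq_integral => x _.
have mFx : measurable_fun setT (fun y => F (x, y)).
  exact: (measurableT_comp mF (pair1_measurable x)).
rewrite /fubini_F vE// -ge0_integralZr//; last 3 first.
- by apply: emeasurable_funM => //; exact/measurable_EFinP.
- by move=> y _; rewrite mule_ge0// lee_fin.
- by rewrite lee_fin.
by apply: eq_integral => y _; rewrite -muleA -EFinM mulrC.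
Qed.

Lemma has_density_power d (T : measurableType d)
    (Q P : {sigma_finite_measure set T -> \bar R}) (u : T -> R) n :
  has_density Q P u ->
  has_density (power_measure Q n) (power_measure P n)
    (fun t => \prod_(i < n) u (tnth t i))%R.
Proof.
move=> du; have [mu u0 uE] := du.
elim: n => [|n ih].
  split=> [|t|F mF F0]; first by apply: measurable_prod => i; case: i.
    by rewrite prodr_ge0.
  by apply: eq_integral => t _; rewrite big_ord0 mule1.
have mp k : measurable_fun setT (fun t : k.-tuple T => \prod_(i < k) u (tnth t i))%R.
  exact: (@measurable_tnth_prod _ _ _ _ (fun=> u)).
split=> [|t|F mF F0]; [exact: mp|by rewrite prodr_ge0|].
rewrite !ge0_integral_power_measure_cons//; last 2 first.
- by apply: emeasurable_funM; [exact: mF|apply/measurable_EFinP; exact: mp].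
- by move=> t; rewrite mule_ge0// lee_fin prodr_ge0.
have [_ _ dE] := has_density_prod du ih.
rewrite dE//; last exact: (measurableT_comp mF (@measurable_cons_pair _ T n)).
apply: eq_integral => -[x t] _.
rewrite big_ord_recl tnth0; congr (_ * (_ * _)%:E).
by apply: eq_bigr => i _; rewrite tnthS.
Qed.

End has_density.

Section le_cam.
Context d (T : measurableType d) (R : realType) (E : finType).
Variables (P : probability T R) (Q : E -> probability T R) (L : E -> T -> R).
Local Open Scope ereal_scope.

(** The average of the [Q e] has density [S / K] with respect to [P], and the hypothesis says that
    this density has variance at most [t ^ 2]. By Cauchy-Schwarz the power of a test against the
    average exceeds its size by at most [t], and some [e] does no better than the average. *)
Lemma second_moment_lower_bound (phi : T -> R) (alpha t : R) :
  (0 < #|E|)%N -> (0 < t)%R ->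
  (forall e, has_density (Q e) P (L e)) ->
  measurable_fun setT phi -> (forall x, 0 <= phi x <= 1)%R ->
  \int[P]_x (phi x)%:E <= alpha%:E ->
  \sum_e \sum_e' \int[P]_x (L e x * L e' x)%:E
    <= (#|E|%:R ^+ 2 * (1 + t ^+ 2))%:E ->
  exists e, (1 - alpha - t)%:E <= \int[Q e]_x (1 - phi x)%:E.
Proof.
move=> E0 t0 dL mphi phi01 phia sm.
pose K : R := #|E|%:R.
have K0 : (0 < K)%R by rewrite ltr0n.
pose S x := (\sum_e L e x)%R.
have mL e : measurable_fun setT (L e) by case: (dL e).
have L0 e x : (0 <= L e x)%R by case: (dL e).
have S0 x : (0 <= S x)%R by rewrite sumr_ge0.
have mS : measurable_fun setT S by exact: measurable_sum.
have phi0 x : (0 <= phi x)%R by case/andP: (phi01 x).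
have intL e : \int[P]_x (L e x)%:E = 1.
  have [_ _ /(_ (cst 1))] := dL e; rewrite integral_cst//= mul1e probability_setT.
  by move=> -> //; apply: eq_integral => x _; rewrite mul1e.
have intS : \int[P]_x (S x)%:E = K%:E.
  under eq_integral do rewrite -sumEFin.
  rewrite ge0_integral_sum//; last 2 first.
  - by move=> e; exact/measurable_EFinP.
  - by move=> e x _; rewrite lee_fin.
  by under eq_bigr do rewrite intL; rewrite sumEFin sumr_const.
have intS2 : \int[P]_x (S x ^+ 2)%:E <= (K ^+ 2 * (1 + t ^+ 2))%:E.
  apply: le_trans sm; rewrite le_eqVlt; apply/orP; left; apply/eqP.
  under [RHS]eq_bigr => e _.
    rewrite -ge0_integral_sum//; last 2 first.
    - by move=> e'; apply/measurable_EFinP; exact: measurable_funM.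
    - by move=> e' x _; rewrite lee_fin mulr_ge0.
    over.
  rewrite -ge0_integral_sum//; last 2 first.
  - move=> e; apply: emeasurable_sum => e'; apply/measurable_EFinP.
    exact: measurable_funM.
  - by move=> e x _; apply: sume_ge0 => e' _; rewrite lee_fin mulr_ge0.
  apply: eq_integral => x _; rewrite expr2 /S mulr_suml -sumEFin.
  by apply: eq_bigr => e _; rewrite mulr_sumr -sumEFin.
apply/not_existsP => /= small.
have phiS : (K * (alpha + t))%:E < \int[P]_x (phi x * S x)%:E.
  (* The power at [e] is a real number because it and the type II error are nonnegative and add up
     to 1. *)
  have phiL e : exists2 a : R, (alpha + t < a)%R & \int[P]_x (phi x * L e x)%:E = a%:E.
    have [_ _ dE] := dL e.
    have intphi : \int[Q e]_x (phi x)%:E + \int[Q e]_x (1 - phi x)%:E = 1.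
      rewrite -ge0_integralD//; last 4 first.
      - by move=> x _; rewrite lee_fin.
      - exact/measurable_EFinP.
      - by move=> x _; rewrite lee_fin subr_ge0; case/andP: (phi01 x).
      - by apply/measurable_EFinP; exact: measurable_funB.
      transitivity (\int[Q e]_x (cst 1 x)); last first.
        by rewrite integral_cst//= mul1e probability_setT.
      by apply: eq_integral => x _; rewrite -EFinD addrC subrK.
    rewrite (_ : \int[P]_x (phi x * L e x)%:E = \int[Q e]_x (phi x)%:E); last first.
      by rewrite dE//; exact/measurable_EFinP.
    have := small e.
    have i0 : 0 <= \int[Q e]_x (phi x)%:E.
      by apply: integral_ge0 => x _; rewrite lee_fin.
    have i1 : 0 <= \int[Q e]_x (1 - phi x)%:E.
      by apply: integral_ge0 => x _; rewrite lee_fin subr_ge0; case/andP: (phi01 x).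
    move: intphi i0 i1.
    case: (\int[Q e]_x (phi x)%:E) => [a| |]//;
      case: (\int[Q e]_x (1 - phi x)%:E) => [b| |]//.
    rewrite -EFinD => -[ab] _ _ /negP; rewrite -ltNge lte_fin => blt.
    by exists a => //; lra.
  have [a aP aE] : exists2 a : E -> R, forall e, (alpha + t < a e)%R &
      forall e, \int[P]_x (phi x * L e x)%:E = (a e)%:E.
    have /choice[a aP] : forall e, exists b : R, (alpha + t < b)%R /\
        \int[P]_x (phi x * L e x)%:E = b%:E.
      by move=> e; have [b ? ?] := phiL e; exists b.
    by exists a => e; have [] := aP e.
  rewrite (_ : \int[P]_x _ = (\sum_e a e)%:E).
    rewrite lte_fin mulrC mulr_natr -sumr_const.
    have /card_gt0P[e0 _] := E0.
    by apply: ltr_sum; [|by move=> e _; exact: aP]; apply/hasP; exists e0;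
        rewrite ?mem_index_enum.
  rewrite -sumEFin -(eq_bigr _ (fun e _ => aE e)) -ge0_integral_sum//; last 2 first.
  - by move=> e; apply/measurable_EFinP; exact: measurable_funM.
  - by move=> e x _; rewrite lee_fin mulr_ge0.
  by apply: eq_integral => x _; rewrite /S mulr_sumr -sumEFin.
have mphiS : measurable_fun setT (fun x => phi x * S x)%R.
  exact: measurable_funM.
have c0 : (0 <= K * t / 2 + K / (2 * t))%R.
  by rewrite addr_ge0// ?divr_ge0 ?mulr_ge0// ltW.
have c1 : (0 <= (2 * t * K)^-1)%R by rewrite invr_ge0 !mulr_ge0// ltW.
have c2 : (0 <= t^-1)%R by rewrite invr_ge0 ltW.
(* Cauchy-Schwarz for [\int phi (S / K - 1)], integrating the pointwise inequality behind
   it: both sides remain integrals of nonnegative functions. *)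
have : \int[P]_x (phi x * S x)%:E + \int[P]_x (t^-1 * S x)%:E <=
   \int[P]_x (K * phi x)%:E + \int[P]_x ((2 * t * K)^-1 * S x ^+ 2)%:E
   + \int[P]_x (K * t / 2 + K / (2 * t))%:E.
  have mS2 : measurable_fun setT (fun x => (2 * t * K)^-1 * S x ^+ 2)%R.
    by apply: measurable_funM => //; exact: measurable_funX.
  have mtS : measurable_fun setT (fun x => t^-1 * S x)%R by exact: measurable_funM.
  have mKphi : measurable_fun setT (fun x => K * phi x)%R by exact: measurable_funM.
  rewrite -!ge0_integralD//=; do ?[by move=> x _; rewrite lee_fin ?mulr_ge0 ?sqr_ge0// ltW
    |exact/measurable_EFinP]; last 2 first.
  - by move=> x _; rewrite -EFinD lee_fin addr_ge0 ?mulr_ge0 ?sqr_ge0// ltW.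
  - by apply/measurable_EFinP; exact: measurable_funD.
  apply: ge0_le_integral => //=.
  - by move=> x _; rewrite -EFinD lee_fin addr_ge0// mulr_ge0.
  - by apply/measurable_EFinP; exact: measurable_funD.
  - by apply/measurable_EFinP; do 2 apply: measurable_funD => //.
  move=> x _; rewrite -!EFinD lee_fin.
  (* In terms of [y] the claim is [phi (y - 1) <= (y - 1)^2 / (2 t) + t / 2], the
     arithmetic-geometric inequality with [phi <= 1]. As [(y - 1)^2] integrates to at most [t^2],
     each term on the right contributes at most [t / 2]. *)
  pose y := (S x / K)%R.
  have -> : S x = (K * y)%R by rewrite /y mulrCA divff ?mulr1// gt_eqF.
  have -> : ((2 * t * K)^-1 * (K * y) ^+ 2 = K * (y ^+ 2 / (2 * t)))%R.
    by field; rewrite !gt_eqF.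
  have -> : (phi x * (K * y) + t^-1 * (K * y) = K * (phi x * y + y / t))%R by ring.
  have -> : (K * phi x + K * (y ^+ 2 / (2 * t)) + (K * t / 2 + K / (2 * t)) =
    K * (phi x + y ^+ 2 / (2 * t) + t / 2 + 1 / (2 * t)))%R by ring.
  rewrite ler_pM2l// -subr_ge0.
  rewrite (_ : (_ - _)%R = ((y - 1 - t * phi x) ^+ 2 + t ^+ 2 * (1 - phi x ^+ 2)) /
      (2 * t))%R; last first.
    by field; rewrite gt_eqF.
  have /andP[p0 p1] := phi01 x.
  rewrite divr_ge0 ?mulr_ge0 ?(ltW t0)// addr_ge0 ?sqr_ge0// mulr_ge0 ?sqr_ge0//.
  by rewrite subr_ge0 expr_le1.
under [X in _ + X <= _ -> _]eq_integral do rewrite EFinM.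
under [X in _ <= X + _ + _ -> _]eq_integral do rewrite EFinM.
under [X in _ <= _ + X + _ -> _]eq_integral do rewrite EFinM.
rewrite ge0_integralZl_EFin//; last 2 first.
- by move=> x _; rewrite lee_fin.
- exact/measurable_EFinP.
rewrite ge0_integralZl_EFin//; last 2 first.
- by move=> x _; rewrite lee_fin.
- exact/measurable_EFinP.
rewrite ge0_integralZl_EFin//; last 2 first.
- by move=> x _; rewrite lee_fin sqr_ge0.
- by apply/measurable_EFinP; exact: measurable_funX.
rewrite integral_cst//= [P _]probability_setT mule1 intS.
apply/negP; rewrite -ltNge.
have : K%:E * (\int[P]_x (phi x)%:E) <= (K * alpha)%:E.
  by rewrite EFinM lee_pmul2l// ?lte_fin.
have : (2 * t * K)^-1%:E * (\int[P]_x (S x ^+ 2)%:E) <=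
    ((2 * t * K)^-1 * (K ^+ 2 * (1 + t ^+ 2)))%:E.
  rewrite EFinM lee_pmul2l// lte_fin invr_gt0 !mulr_gt0//.
move=> h1 h2.
apply: (@le_lt_trans _ _ (K * (alpha + t) + t^-1 * K)%:E); last first.
  by rewrite EFinD EFinM lteD2rE.
rewrite (_ : (K * (alpha + t) + t^-1 * K)%:E = (K * alpha)%:E +
    ((2 * t * K)^-1 * (K ^+ 2 * (1 + t ^+ 2)))%:E + (K * t / 2 + K / (2 * t))%:E); last first.
  by rewrite -!EFinD; congr EFin; field; rewrite !gt_eqF.
by rewrite !leeD.
Qed.

End le_cam.

(** * Calculus on intervals of the real line *)

Section interval_calculus.
Context {R : realType}.
Implicit Types (f F G : R -> R) (a b : R).
Local Notation leb := (@lebesgue_measure R).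

Lemma continuous_integrable_itv f a b : continuous f ->
  leb.-integrable `[a, b] (EFin \o f).
Proof.
move=> cf; apply: continuous_compact_integrable; first exact: segment_compact.
exact: continuous_subspaceT.
Qed.

Lemma Rintegral_is_derive F f a b : a < b ->
  (forall x : R, is_derive x (1:R) F (f x)) -> continuous f ->
  \int[leb]_(x in `[a, b]) f x = F b - F a.
Proof.
move=> ab dF cf.
have cF : continuous F.
  move=> x; apply/differentiable_continuous/derivable1_diffP.
  by case: (dF x).
rewrite /Rintegral (@continuous_FTC2 _ f F)//.
- exact: continuous_subspaceT.
- split=> [x _| |]; first by case: (dF x).
  + by apply: cvg_at_right_filter; exact: cF.
  + by apply: cvg_at_left_filter; exact: cF.
- by move=> x _; rewrite derive1E; apply: derive_val.
Qed.

Lemma Rintegral_affine G (delta k : R) : 0 < delta -> continuous G ->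
  \int[leb]_(x in `[delta * k, delta * (k + 1)]) G x =
  delta * \int[leb]_(t in `[0, 1]) G (delta * (t + k)).
Proof.
move=> d0 cG.
pose F (t : R) := delta * (t + k).
have dF (x : R) : is_derive x (1:R) F delta.
  rewrite (_ : F = horner (delta *: ('X + k%:P))); last first.
    by apply/funext => t; rewrite !hornerE.
  have := is_derive_poly (delta *: ('X + k%:P)) x.
  by rewrite derivZ derivD derivX derivC addr0 !hornerE.
have F'E : F^`()%classic = cst delta.
  by apply/funext => x; rewrite derive1E; apply: derive_val.
have cF : continuous F.
  by move=> x; apply/differentiable_continuous/derivable1_diffP; case: (dF x).
rewrite -RintegralZl//; last first.
  by apply: continuous_integrable_itv => x; apply: continuous_comp; [exact: cF|exact: cG].
have -> : `[delta * k, delta * (k + 1)]%classic = `[F 0, F 1]%classic.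
  by rewrite /F add0r (addrC k).
rewrite /Rintegral (@integration_by_substitution_increasing _ F G 0 1)//.
- congr fine; apply: eq_integral => x _ /=.
  by rewrite F'E /= mulrC.
- by move=> x y _ _ xy; rewrite /F ltr_pM2l// ltrD2r.
- by rewrite F'E => x _; exact: cst_continuous.
- by rewrite F'E; exact: is_cvg_cst.
- by rewrite F'E; exact: is_cvg_cst.
- split=> [x _| |]; first by case: (dF x).
  + by apply: cvg_at_right_filter; exact: cF.
  + by apply: cvg_at_left_filter; exact: cF.
- exact: continuous_subspaceT.
Qed.

End interval_calculus.

(** * Fourier coefficients of polynomial bumps *)

Section trigonometric_moments.
Context {R : realType}.
Implicit Types (q : {poly R}) (z w t : R).
Local Notation leb := (@lebesgue_measure R).

Lemma is_derive_cosM z t : is_derive t (1:R) (fun t => cos (z * t)) (- (z * sin (z * t))).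
Proof.
have dz : is_derive t (1:R) (fun t => z * t) z.
  have := is_derive_poly (z *: 'X) t.
  rewrite derivZ derivX (_ : horner _ = (fun t => z * t)) ?hornerE ?mulr1//.
  by apply/funext => u; rewrite !hornerE.
have := @is_derive1_comp _ (@cos R) (fun t => z * t) t _ _ (is_derive_cos _) dz.
by rewrite mulNr mulrC.
Qed.

Lemma is_derive_sinM z t : is_derive t (1:R) (fun t => sin (z * t)) (z * cos (z * t)).
Proof.
have dz : is_derive t (1:R) (fun t => z * t) z.
  have := is_derive_poly (z *: 'X) t.
  rewrite derivZ derivX (_ : horner _ = (fun t => z * t)) ?hornerE ?mulr1//.
  by apply/funext => u; rewrite !hornerE.
have := @is_derive1_comp _ (@sin R) (fun t => z * t) t _ _ (is_derive_sin _) dz.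
by rewrite mulrC.
Qed.

Lemma continuous_cosM z : continuous (fun t : R => cos (z * t)).
Proof.
move=> t; apply/differentiable_continuous/derivable1_diffP.
by case: (is_derive_cosM z t).
Qed.

Lemma continuous_scalel z (f : R -> R) : continuous f -> continuous (fun t => z * f t).
Proof. by move=> cf t; apply: continuousM; [exact: cst_continuous|exact: cf]. Qed.

Lemma continuous_addf (f g : R -> R) : continuous f -> continuous g ->
  continuous (fun t => f t + g t).
Proof. by move=> cf cg t; exact: (continuousD (cf t) (cg t)). Qed.

Lemma continuous_subf (f g : R -> R) : continuous f -> continuous g ->
  continuous (fun t => f t - g t).
Proof. by move=> cf cg t; exact: (continuousB (cf t) (cg t)). Qed.

Lemma continuous_mulf (f g : R -> R) : continuous f -> continuous g ->
  continuous (fun t => f t * g t).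
Proof. by move=> cf cg t; exact: (continuousM (cf t) (cg t)). Qed.

Lemma continuous_normr (f : R -> R) : continuous f -> continuous (fun t => `|f t|).
Proof.
by move=> cf t; apply: continuous_comp; [exact: cf|exact: norm_continuous].
Qed.

Lemma continuous_sinM z : continuous (fun t : R => sin (z * t)).
Proof.
move=> t; apply/differentiable_continuous/derivable1_diffP.
by case: (is_derive_sinM z t).
Qed.

(** Together with [sin_moment], the real part and the opposite of the imaginary part of the Fourier
    transform of [q] restricted to [[0, 1]]; [sq_moment] below is its squared modulus. *)
Definition cos_moment q z := \int[leb]_(t in `[0, 1]) (q.[t] * cos (z * t)).
Definition sin_moment q z := \int[leb]_(t in `[0, 1]) (q.[t] * sin (z * t)).

Lemma continuous_cos_moment q z : continuous (fun t => q.[t] * cos (z * t)).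
Proof.
by move=> t; apply: continuousM; [exact: continuous_horner|exact: continuous_cosM].
Qed.

Lemma continuous_sin_moment q z : continuous (fun t => q.[t] * sin (z * t)).
Proof.
by move=> t; apply: continuousM; [exact: continuous_horner|exact: continuous_sinM].
Qed.

(** Integration by parts, done by integrating the derivative of [q(t) cos(z t)]: the boundary terms
    vanish with [q] at 0 and 1. *)
Lemma sin_moment_deriv q z : q.[0] = 0 -> q.[1] = 0 ->
  z * sin_moment q z = cos_moment q^`() z.
Proof.
move=> q0 q1; apply/eqP; rewrite eq_sym -subr_eq0; apply/eqP.
rewrite /sin_moment /cos_moment -RintegralZl//; last first.
  exact/continuous_integrable_itv/continuous_sin_moment.
have iz : leb.-integrable `[0, 1] (EFin \o (fun t => z * (q.[t] * sin (z * t)))).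
  exact/continuous_integrable_itv/continuous_scalel/continuous_sin_moment.
rewrite -RintegralB//; last exact/continuous_integrable_itv/continuous_cos_moment.
have dF (t : R) : is_derive t (1:R) (fun t => q.[t] * cos (z * t))
    (q^`().[t] * cos (z * t) - z * (q.[t] * sin (z * t))).
  have := is_deriveM (is_derive_poly q t) (is_derive_cosM z t).
  by move=> h; apply: (is_derive_eq h); rewrite /GRing.scale /=; ring.
rewrite (Rintegral_is_derive ltr01 dF) ?q0 ?q1 ?mul0r ?subrr//.
apply: continuous_subf; first exact: continuous_cos_moment.
exact/continuous_scalel/continuous_sin_moment.
Qed.

Lemma cos_moment_deriv q z : q.[0] = 0 -> q.[1] = 0 ->
  z * cos_moment q z = - sin_moment q^`() z.
Proof.
move=> q0 q1; apply/eqP; rewrite -subr_eq0 opprK; apply/eqP.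
rewrite /sin_moment /cos_moment -RintegralZl//; last first.
  exact/continuous_integrable_itv/continuous_cos_moment.
have iz : leb.-integrable `[0, 1] (EFin \o (fun t => z * (q.[t] * cos (z * t)))).
  exact/continuous_integrable_itv/continuous_scalel/continuous_cos_moment.
rewrite addrC -RintegralD//; last exact/continuous_integrable_itv/continuous_sin_moment.
have dF (t : R) : is_derive t (1:R) (fun t => q.[t] * sin (z * t))
    (q^`().[t] * sin (z * t) + z * (q.[t] * cos (z * t))).
  have := is_deriveM (is_derive_poly q t) (is_derive_sinM z t).
  by move=> h; apply: (is_derive_eq h); rewrite /GRing.scale /=; ring.
rewrite (Rintegral_is_derive ltr01 dF) ?q0 ?q1 ?mul0r ?subrr//.
apply: continuous_addf; first exact: continuous_sin_moment.
exact/continuous_scalel/continuous_cos_moment.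
Qed.

Definition sq_moment q z := cos_moment q z ^+ 2 + sin_moment q z ^+ 2.

Lemma sq_moment_deriv q z : q.[0] = 0 -> q.[1] = 0 ->
  z ^+ 2 * sq_moment q z = sq_moment q^`() z.
Proof.
move=> q0 q1; rewrite /sq_moment -sin_moment_deriv// -[sin_moment _^`() _]opprK.
rewrite -cos_moment_deriv//; ring.
Qed.

Lemma sq_moment_derivn q z n :
  (forall i, (i < n)%N -> q^`(i).[0] = 0 /\ q^`(i).[1] = 0) ->
  z ^+ (2 * n) * sq_moment q z = sq_moment q^`(n) z.
Proof.
elim: n => [|n ih] q01; first by rewrite muln0 mul1r derivn0.
have [q0 q1] := q01 n (ltnSn _).
rewrite derivnS -sq_moment_deriv// -ih; last by move=> i /ltnW; exact: q01.
by rewrite mulrA -exprD mulnS.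
Qed.

Lemma sq_moment_le q : exists2 B, 0 <= B & forall z, sq_moment q z <= B.
Proof.
pose c := \int[leb]_(t in `[0, 1]) `|q.[t]|.
have cq : continuous (fun t => `|q.[t]|).
  exact/continuous_normr/continuous_horner.
have c0 : 0 <= c by apply: Rintegral_ge0 => t _.
exists (c ^+ 2 + c ^+ 2); first by rewrite addr_ge0 ?sqr_ge0.
move=> z; apply: lerD; rewrite -[X in X <= _]real_normK ?num_real// lerXn2r ?nnegrE//.
- apply: le_trans (le_normr_Rintegral _ _) _ => //.
    exact/continuous_integrable_itv/continuous_cos_moment.
  apply: le_Rintegral => //.
  + exact/continuous_integrable_itv/continuous_normr/continuous_cos_moment.
  + exact: continuous_integrable_itv.
  + by move=> t _; rewrite normrM ler_piMr// ler_norml cos_geN1 cos_le1.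
- apply: le_trans (le_normr_Rintegral _ _) _ => //.
    exact/continuous_integrable_itv/continuous_sin_moment.
  apply: le_Rintegral => //.
  + exact/continuous_integrable_itv/continuous_normr/continuous_sin_moment.
  + exact: continuous_integrable_itv.
  + by move=> t _; rewrite normrM ler_piMr// ler_norml sin_geN1 sin_le1.
Qed.

(** Expand [(1 + z ^ 2) ^ n]. By repeated integration by parts [z ^ (2 i)] turns the squared
    transform of [q] into that of its [i]-th derivative, which is bounded in [z]. *)
Lemma sq_moment_decay q n :
  (forall i, (i < n)%N -> q^`(i).[0] = 0 /\ q^`(i).[1] = 0) ->
  exists2 B, 0 < B & forall z, (1 + z ^+ 2) ^+ n * sq_moment q z <= B.
Proof.
move=> q01.
have /choice[B BP] : forall i, exists B, 0 <= B /\ forall z, sq_moment q^`(i) z <= B.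
  by move=> i; have [B ? ?] := sq_moment_le q^`(i); exists B.
exists (1 + \sum_(i < n.+1) B i *+ 'C(n, i)).
  by rewrite ltr_wpDr// sumr_ge0// => i _; rewrite mulrn_wge0//; case: (BP i).
move=> z; rewrite ler_wpDl// exprDn mulr_suml; apply: ler_sum => i _.
rewrite expr1n mul1r mulrnAl -exprM.
rewrite lerMn2r; apply/orP; right.
rewrite sq_moment_derivn; first by case: (BP i).
by move=> j ji; apply: q01; apply: leq_trans ji _; rewrite -ltnS.
Qed.

End trigonometric_moments.

Section bump.
Context {R : realType}.
Local Notation leb := (@lebesgue_measure R).

(** Each derivation costs at most one factor ['X - a]. *)
Lemma derivn_root_pow (a : R) (q : {poly R}) n i : (i <= n)%N ->
  exists r, (('X - a%:P) ^+ n * q)^`(i) = ('X - a%:P) ^+ (n - i) * r.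
Proof.
elim: i => [_|i ih ltin]; first by exists q; rewrite subn0.
have [r rE] := ih (ltnW ltin).
rewrite derivnS rE -(subnSK ltin) derivM deriv_exp derivXsubC mul1r /=.
exists (r *+ (n - i.+1).+1 + ('X - a%:P) * r^`()).
by rewrite mulrDr mulrnAl mulrnAr mulrA -exprSr.
Qed.

Variable s : nat.

(* A derivative, so that the bump has mean zero, of a polynomial whose order of vanishing
   at [0] and [1] makes the Fourier transform of the bump decay like [|z|^-(s+1)]. *)
Definition bump_primitive : {poly R} := ('X * (1 - 'X)) ^+ s.+2.
Definition bump_poly : {poly R} := bump_primitive^`().

Lemma bump_poly_derivn0 i : (i < s.+1)%N ->
  bump_poly^`(i).[0] = 0 /\ bump_poly^`(i).[1] = 0.
Proof.
move=> ls; rewrite /bump_poly -derivSn /bump_primitive.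
have lis : (i.+1 <= s.+2)%N by rewrite ltnW.
(* [bump_poly] is already a first derivative, so its [i]-th derivative is the [i.+1]-st of the
   primitive; the order [s.+2] still leaves one vanishing factor. *)
have pos : (0 < s.+2 - i.+1)%N by rewrite subn_gt0.
split.
- rewrite exprMn -{1}['X]subr0.
  have [r ->] := derivn_root_pow 0 ((1 - 'X) ^+ s.+2) lis.
  by rewrite hornerM horner_exp hornerXsubC subrr expr0n gtn_eqF// mul0r.
- rewrite exprMn mulrC -opprB -mulN1r exprMn -mulrA mulrCA.
  have [r ->] := derivn_root_pow 1 ((-1) ^+ s.+2 * 'X ^+ s.+2) lis.
  by rewrite hornerM horner_exp hornerXsubC subrr expr0n gtn_eqF// mul0r.
Qed.

(** Cut off outside the open interval, so that bumps on adjacent cells are never both nonzero. As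
    the polynomial vanishes at 0 and 1, the two still agree on the closed interval, where the
    calculus takes place. *)
Definition bump (t : R) : R := if 0 < t < 1 then bump_poly.[t] else 0.

Lemma bump_out t : ~~ (0 < t < 1) -> bump t = 0.
Proof. by rewrite /bump => /negbTE ->. Qed.

Lemma bump_itv t : 0 <= t <= 1 -> bump t = bump_poly.[t].
Proof.
have [b0 b1] := bump_poly_derivn0 (ltn0Sn s).
rewrite derivn0 in b0 b1.
rewrite /bump => /andP[]; rewrite le_eqVlt => /predU1P[<- _|->/=].
  by rewrite ltxx.
by rewrite le_eqVlt => /predU1P[->|->//]; rewrite ltxx.
Qed.

Lemma measurable_bump : measurable_fun setT bump.
Proof.
rewrite /bump; apply: measurable_fun_ifT => //.
- apply: measurable_and; exact: measurable_fun_ltr.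
- by apply: continuous_measurable_fun; exact: continuous_horner.
Qed.

Lemma bump_bound : exists2 B, 0 < B & forall t, `|bump t| <= B.
Proof.
pose B := 1 + \sum_(i < size bump_poly) `|bump_poly`_i|.
exists B; first by rewrite ltr_wpDr// sumr_ge0.
move=> t; rewrite /bump; case: ifPn => [/andP[t0 t1]|_]; last first.
  by rewrite normr0 addr_ge0// sumr_ge0.
rewrite horner_coef; apply: le_trans (ler_norm_sum _ _ _) _.
rewrite ler_wpDl//; apply: ler_sum => i _.
rewrite normrM ler_piMr// normrX exprn_ile1// ger0_norm ltW//.
Qed.

Lemma bump_primitive0 : bump_primitive.[0] = 0.
Proof. by rewrite horner_exp hornerM hornerX mul0r expr0n. Qed.

Lemma bump_primitive1 : bump_primitive.[1] = 0.
Proof.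
by rewrite horner_exp hornerM hornerD hornerN hornerX hornerC subrr mulr0 expr0n.
Qed.

Lemma int_bump_poly : \int[leb]_(t in `[0, 1]) bump_poly.[t] = 0.
Proof.
rewrite (Rintegral_is_derive ltr01 (is_derive_poly bump_primitive)).
  by rewrite bump_primitive0 bump_primitive1 subrr.
exact: continuous_horner.
Qed.

Lemma int_bump_poly_sqr_gt0 : 0 < \int[leb]_(t in `[0, 1]) (bump_poly.[t] ^+ 2).
Proof.
have cb : continuous (horner bump_poly) by exact: continuous_horner.
have cb2 : continuous (fun t => bump_poly.[t] ^+ 2).
  have -> : (fun t => bump_poly.[t] ^+ 2) = (fun t => bump_poly.[t] * bump_poly.[t]).
    by apply/funext => t; rewrite expr2.
  exact: continuous_mulf.
(* Integrate [b ^ 2 >= 4 v b - 4 v ^ 2] over [0, 1/2], where [b] has integral [v]. *)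
pose v := bump_primitive.[2^-1].
have v0 : 0 < v.
  by rewrite /v /bump_primitive horner_exp exprn_gt0// !hornerE; lra.
have h0 : (0 : R) < 2^-1 by lra.
have iv : \int[leb]_(t in `[0, 2^-1]) bump_poly.[t] = v.
  rewrite (Rintegral_is_derive h0 (is_derive_poly bump_primitive))//.
  by rewrite bump_primitive0 subr0.
apply: (@lt_le_trans _ _ (\int[leb]_(t in `[0, 2^-1]) (bump_poly.[t] ^+ 2))).
  pose q := (4 * v) *: bump_primitive - (4 * v ^+ 2) *: 'X.
  have q'E : q^`() = (4 * v) *: bump_poly - (4 * v ^+ 2)%:P.
    by rewrite derivB !derivZ derivX -mul_polyC alg_polyC.
  have intq : \int[leb]_(t in `[0, 2^-1]) q^`().[t] = 2 * v ^+ 2.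
    rewrite (Rintegral_is_derive h0 (is_derive_poly q)); last exact: continuous_horner.
    rewrite /q !(hornerD, hornerN, hornerZ, hornerX) -/v bump_primitive0; lra.
  apply: (@lt_le_trans _ _ (\int[leb]_(t in `[0, 2^-1]) q^`().[t])).
    by rewrite intq mulr_gt0// exprn_gt0.
  apply: le_Rintegral => //.
  - exact/continuous_integrable_itv/continuous_horner.
  - exact: continuous_integrable_itv.
  have sq (y : R) : 4 * v * y - 4 * v ^+ 2 <= y ^+ 2.
    by rewrite -subr_ge0 (_ : _ - _ = (y - 2 * v) ^+ 2) ?sqr_ge0//; ring.
  by move=> t _; rewrite q'E hornerD hornerN hornerZ hornerC; exact: sq.
rewrite /Rintegral fine_le//.
- apply: integrable_fin_num => //; exact: continuous_integrable_itv.
- apply: integrable_fin_num => //; exact: continuous_integrable_itv.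
apply: ge0_subset_integral => //.
- by apply/measurable_EFinP/measurable_funTS; exact: continuous_measurable_fun.
- by move=> t _; rewrite lee_fin sqr_ge0.
- by move=> t /=; rewrite !in_itv/= => /andP[-> ?]; lra.
Qed.

End bump.

Section bump_affine.
Context {R : realType}.
Local Notation leb := (@lebesgue_measure R).
Variables (s : nat) (delta k : R).
Hypothesis delta0 : 0 < delta.

Local Notation bmp := (@bump R s).
Local Notation b := (@bump_poly R s).

(** Trades the cut-off in the integrand for a compact domain on which the integrand is
    continuous. *)
Lemma bump_affine_patch (g : R -> R) :
  (fun x => bmp (x / delta - k) * g x) =
  (fun x => b.[x / delta - k] * g x) \_ `[delta * k, delta * (k + 1)].
Proof.
apply/funext => x; rewrite patchE; case: ifPn.
  rewrite inE/= in_itv/= => /andP[x0 x1]; rewrite bump_itv//.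
  rewrite subr_ge0 ler_pdivlMr// mulrC x0/= lerBlDr ler_pdivrMr//.
  by rewrite mulrC (addrC 1).
move=> /negP xn; rewrite bump_out ?mul0r//; apply/negP => /andP[x0 x1]; apply: xn.
rewrite inE/= in_itv/=; move: x0 x1.
rewrite subr_gt0 ltr_pdivlMr// mulrC => /ltW ->/=.
by rewrite ltrBlDr ltr_pdivrMr// mulrC (addrC 1) => /ltW.
Qed.

Lemma continuous_poly_affine : continuous (fun x : R => b.[x / delta - k]).
Proof.
have -> : (fun x => b.[x / delta - k]) = horner (b \Po (delta^-1 *: 'X - k%:P)).
  by apply/funext => x; rewrite horner_comp !(hornerD, hornerN, hornerZ, hornerX, hornerC)
      mulrC.
exact: continuous_horner.
Qed.

Lemma integrable_bump_affine (g : R -> R) : continuous g ->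
  leb.-integrable setT (EFin \o (fun x => bmp (x / delta - k) * g x)).
Proof.
move=> cg; rewrite bump_affine_patch -restrict_EFin.
apply/(integrable_mkcond _ _).1 => //; apply: continuous_integrable_itv.
exact: (continuous_mulf continuous_poly_affine).
Qed.

Lemma Rintegral_bump_affine (g : R -> R) : continuous g ->
  \int[leb]_x (bmp (x / delta - k) * g x) =
  delta * \int[leb]_(t in `[0, 1]) (b.[t] * g (delta * (t + k))).
Proof.
move=> cg; rewrite bump_affine_patch -Rintegral_mkcond Rintegral_affine//; last first.
  exact: (continuous_mulf continuous_poly_affine).
congr *%R; apply: eq_Rintegral => t _.
by rewrite [delta * _ / _]mulrC mulKf ?addrK// gt_eqF.
Qed.

Lemma Rintegral_bump_affine0 : \int[leb]_x (bmp (x / delta - k)) = 0.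
Proof.
transitivity (\int[leb]_x (bmp (x / delta - k) * cst 1 x)).
  by apply: eq_Rintegral => x _; rewrite mulr1.
rewrite Rintegral_bump_affine; last exact: cst_continuous.
under eq_Rintegral do rewrite mulr1.
by rewrite int_bump_poly mulr0.
Qed.

Lemma integrable_bump_affine0 : leb.-integrable setT (EFin \o (fun x => bmp (x / delta - k))).
Proof.
rewrite (_ : (fun x => _) = (fun x => bmp (x / delta - k) * cst 1 x)).
  by apply: integrable_bump_affine; exact: cst_continuous.
by apply/funext => x; rewrite mulr1.
Qed.

(** Replacing one factor by the polynomial brings the square under the rules for a bump times a
    continuous function. *)
Lemma bump_affine_sqrE x : bmp (x / delta - k) ^+ 2 = bmp (x / delta - k) * b.[x / delta - k].
Proof.
rewrite expr2; have [t01|t01] := boolP (0 < x / delta - k < 1).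
  by congr *%R; rewrite /bump t01.
by rewrite bump_out// !mul0r.
Qed.

Lemma integrable_bump_affine_sqr :
  leb.-integrable setT (EFin \o (fun x => bmp (x / delta - k) ^+ 2)).
Proof.
rewrite (_ : (fun x => _) = (fun x => bmp (x / delta - k) * b.[x / delta - k])).
  exact: (integrable_bump_affine continuous_poly_affine).
by apply/funext => x; rewrite bump_affine_sqrE.
Qed.

Lemma Rintegral_bump_affine_sqr : \int[leb]_x (bmp (x / delta - k) ^+ 2) =
  delta * \int[leb]_(t in `[0, 1]) (b.[t] ^+ 2).
Proof.
under eq_Rintegral do rewrite bump_affine_sqrE.
rewrite Rintegral_bump_affine; last exact: continuous_poly_affine.
congr *%R; apply: eq_Rintegral => t _.
by rewrite [delta * _]mulrC mulfK ?addrK ?expr2// gt_eqF.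
Qed.

Definition bump_fourier (z : R) : R[i] := Complex (cos_moment b z) (- sin_moment b z).

(** Dilation by [delta] rescales the frequency and gives the factor [delta]; translation by
    [delta * k] gives the phase, split off by the addition formulas. *)
Lemma cintegral_bump_affine (xi : R) :
  let F := fun x => (bmp (x / delta - k))%:C%C * expNi (x * xi) in
  cintegrable leb F /\
  cintegral leb F = delta%:C%C * expNi (delta * k * xi) * bump_fourier (delta * xi).
Proof.
move=> F.
have ReF x : complex.Re (F x) = bmp (x / delta - k) * cos (xi * x).
  by rewrite /F /expNi /= mul0r subr0 [x * xi]mulrC.
have ImF x : complex.Im (F x) = bmp (x / delta - k) * - sin (xi * x).
  by rewrite /F /expNi /= mul0r addr0 [x * xi]mulrC.
have cs : continuous (fun x => - sin (xi * x)).
  have -> : (fun x => - sin (xi * x)) = (fun x => -1 * sin (xi * x)).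
    by apply/funext => x; rewrite mulN1r.
  exact/continuous_scalel/continuous_sinM.
have ic := continuous_integrable_itv 0 1 (@continuous_cos_moment _ b (delta * xi)).
have isn := continuous_integrable_itv 0 1 (@continuous_sin_moment _ b (delta * xi)).
split.
  split.
  - rewrite (_ : (fun x => _) = (fun x => bmp (x / delta - k) * cos (xi * x))).
      exact/integrable_bump_affine/continuous_cosM.
    by apply/funext => x; rewrite ReF.
  - rewrite (_ : (fun x => _) = (fun x => bmp (x / delta - k) * - sin (xi * x))).
      exact: integrable_bump_affine.
    by apply/funext => x; rewrite ImF.
rewrite /cintegral.
under eq_Rintegral do rewrite ReF.
under [X in Complex _ X]eq_Rintegral do rewrite ImF.
rewrite Rintegral_bump_affine//; last exact: continuous_cosM.
rewrite Rintegral_bump_affine//.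
set w := delta * k * xi; set z := delta * xi.
have wz t : xi * (delta * (t + k)) = z * t + w by rewrite /w /z; ring.
have cosE t : b.[t] * cos (xi * (delta * (t + k))) =
    cos w * (b.[t] * cos (z * t)) - sin w * (b.[t] * sin (z * t)).
  by rewrite wz cosD; ring.
under eq_Rintegral do rewrite cosE.
rewrite RintegralB//; [|exact/continuous_integrable_itv/continuous_scalel/continuous_cos_moment
  |exact/continuous_integrable_itv/continuous_scalel/continuous_sin_moment].
rewrite !RintegralZl//.
have sinE t : b.[t] * - sin (xi * (delta * (t + k))) =
    - sin w * (b.[t] * cos (z * t)) - cos w * (b.[t] * sin (z * t)).
  by rewrite wz sinD; ring.
under [X in Complex _ (_ * X)]eq_Rintegral do rewrite sinE.
rewrite RintegralB//; [|exact/continuous_integrable_itv/continuous_scalel/continuous_cos_moment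
  |exact/continuous_integrable_itv/continuous_scalel/continuous_sin_moment].
rewrite !RintegralZl// -/(cos_moment b z) -/(sin_moment b z).
by apply/eqP; rewrite eq_complex /=; apply/andP; split; apply/eqP; ring.
Qed.

End bump_affine.

(** * Weights constant on shells *)

Section shell_weight.
Context {R : realType}.
Local Notation leb := (@lebesgue_measure R).
Variable r : R.
Hypothesis r0 : 0 < r.

Definition shell (j : nat) : set R := [set x | j%:R * r <= `|x| < j.+1%:R * r].

(* Of the order of [1 / (1 + (x / r) ^ 2)], but with equal values on a whole shell: a
   function of period [r] with mean zero is then orthogonal to it. *)
Definition shell_weight (x : R) : R :=
  let j := Num.truncn (`|x| / r) in (j.+1%:R * j.+2%:R)^-1.

Lemma shellP j x : shell j x <-> Num.truncn (`|x| / r) = j.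
Proof.
rewrite /shell/=.
have x0 : 0 <= `|x| / r by rewrite divr_ge0// ltW.
have -> : (j%:R * r <= `|x| < j.+1%:R * r) = (Num.truncn (`|x| / r) == j).
  by rewrite truncn_eq// ler_pdivlMr// ltr_pdivrMr.
by split=> /eqP.
Qed.

Lemma shell_setD j : shell j =
  `] - (j.+1%:R * r), j.+1%:R * r[ `\` `] - (j%:R * r), j%:R * r[.
Proof.
apply/seteqP; split => x /=; rewrite /shell/= !in_itv/= -!ltr_norml.
  by move=> /andP[jx xj]; split=> //; apply/negP; rewrite -leNgt.
by move=> [xj /negP]; rewrite -leNgt => ->.
Qed.

Lemma measurable_shell j : measurable (shell j).
Proof. by rewrite shell_setD; exact: measurableD. Qed.

Lemma bigcup_shell : \bigcup_j shell j = setT.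
Proof. by apply/seteqP; split=> // x _; exists (Num.truncn (`|x| / r)) => //;
    apply/shellP. Qed.

Lemma trivIset_shell : trivIset setT shell.
Proof.
apply/trivIsetP => i j _ _; apply: contra_neq_eq => /set0P[x [/shellP xi /shellP xj]].
by rewrite -xi -xj.
Qed.

Lemma shell_weight_gt0 x : 0 < shell_weight x.
Proof. by rewrite invr_gt0 mulr_gt0. Qed.

Lemma measurable_shell_weight : measurable_fun setT shell_weight.
Proof.
rewrite -bigcup_shell; apply/measurable_fun_bigcup; first exact: measurable_shell.
move=> j; have mc : measurable_fun (shell j) (cst (j.+1%:R * j.+2%:R)^-1 : R -> R) by [].
apply: eq_measurable_fun mc.
by move=> x; rewrite inE => /shellP xj; rewrite /shell_weight xj.
Qed.

(** On the [j]-th shell [j <= |x| / r <= |e x|], and [(j + 1) (j + 2) <= 4 (1 + j^2)] for every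
    [j]. *)
Lemma shell_weight_ge e x : 0 < e -> 1 <= e * r -> (1 + (e * x) ^+ 2)^-1 <= 4 * shell_weight x.
Proof.
move=> e0 er; rewrite /shell_weight; set j := Num.truncn _.
have jx : j%:R <= `|e * x|.
  have /andP[jx _] : j%:R <= `|x| / r < j.+1%:R by rewrite truncn_itv// divr_ge0// ltW.
  rewrite normrM (gtr0_norm e0) (le_trans jx)// mulrC ler_wpM2r// -[r^-1]mul1r.
  by rewrite ler_pdivrMr.
rewrite -[4]invrK -invfM lef_pV2 ?posrE ?mulr_gt0//; last first.
  by rewrite ltr_pwDl// sqr_ge0.
rewrite ler_pdivrMl// -[(e * x) ^+ 2]real_normK ?num_real//.
have : j%:R ^+ 2 <= `|e * x| ^+ 2 by rewrite lerXn2r ?nnegrE.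
have : 0 <= (j%:R : R) by [].
rewrite -(natr1 j.+1) -(natr1 j); nra.
Qed.

(** The total mass of the weight, every shell having Lebesgue measure [2 * r]. It stays a series:
    what matters later is that it is finite and at most [2 * r]. *)
Definition shell_mass : \bar R := (\sum_(0 <= j <oo) (2 * r / (j.+1%:R * j.+2%:R))%:E)%E.

(** Differences over consecutive symmetric intervals show that [g] has the same integral as the
    constant 1 on each shell, where the weight is constant. Nonnegativity of [g] allows summing over
    the shells. *)
Lemma ge0_integral_shell_weight (g : R -> R) : continuous g ->
  (forall x, 0 <= g x) ->
  (forall j : nat, \int[leb]_(x in `[- (j%:R * r), j%:R * r]) g x = 2 * (j%:R * r)) ->
  (\int[leb]_x (shell_weight x * g x)%:E = shell_mass)%E.
Proof.
move=> cg g0 gE.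
have mg A : measurable_fun A (EFin \o g).
  by apply/measurable_EFinP/measurable_funTS; exact: continuous_measurable_fun.
have ball j : (\int[leb]_(x in `](- (j%:R * r))%R, (j%:R * r)%R[) (g x)%:E =
    (2 * (j%:R * r))%:E)%E.
  rewrite -(integral_itv_bndoo true false)// -gE /Rintegral fineK//.
  by apply: integrable_fin_num => //; exact: continuous_integrable_itv.
have shell_int j : (\int[leb]_(x in shell j) (g x)%:E = (2 * r)%:E)%E.
  have sub : `] - (j%:R * r), j%:R * r[ `<=` `] - (j.+1%:R * r), j.+1%:R * r[.
    move=> x /=; rewrite !in_itv/= -!ltr_norml => /lt_le_trans; apply.
    by rewrite ler_pM2r// ler_nat.
  have := ball j.+1.
  rewrite -(setDUK sub) ge0_integral_setU//; last 4 first.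
  - exact: measurableD.
  - exact: mg.
  - by move=> x _; rewrite lee_fin.
  - by apply/disj_setPS => x [? []].
  rewrite ball -shell_setD.
  case: (integral _ _ _) => [a| |]//; rewrite -EFinD => -[aE].
  by congr EFin; move: aE; rewrite -(natr1 j); lra.
rewrite -bigcup_shell ge0_integral_bigcup//; last 4 first.
- exact: measurable_shell.
- rewrite bigcup_shell; apply/measurable_EFinP; apply: measurable_funM.
    exact: measurable_shell_weight.
  exact: continuous_measurable_fun.
- by move=> x _; rewrite lee_fin mulr_ge0// ltW// shell_weight_gt0.
- exact: trivIset_shell.
apply: eq_eseriesr => j _.
transitivity (\int[leb]_(x in shell j) ((j.+1%:R * j.+2%:R)^-1%:E * (g x)%:E))%E.
  apply: eq_integral => x; rewrite inE => /shellP xj.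
  by rewrite /shell_weight xj EFinM.
rewrite ge0_integralZl//; last 3 first.
- exact: measurable_shell.
- exact: mg.
- by move=> x _; rewrite lee_fin.
by rewrite shell_int -EFinM mulrC.
Qed.

Lemma shell_mass_le : (shell_mass <= (2 * r)%:E)%E.
Proof.
apply: lime_le.
  by apply: is_cvg_nneseries => j _ _; rewrite lee_fin divr_ge0 ?mulr_ge0// ltW.
apply: nearW => n; rewrite sumEFin lee_fin -mulr_sumr ler_piMr ?mulr_ge0 ?(ltW r0)//.
(* The terms are [1 / (j + 1) - 1 / (j + 2)], so the sum telescopes. *)
rewrite (_ : \sum_(0 <= j < n) _ = 1 - n.+1%:R^-1) ?gerBl ?invr_ge0//.
elim: n => [|n ih]; first by rewrite big_geq// invr1 subrr.
rewrite big_nat_recr//= ih -(natr1 n.+1).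
have : n.+1%:R + 1 != 0 :> R by rewrite natr1 pnatr_eq0.
have : n.+1%:R != 0 :> R by rewrite pnatr_eq0.
by move: (n.+1%:R : R) => x x0 x1; field; rewrite x0 x1.
Qed.

Lemma shell_mass_ge0 : (0 <= shell_mass)%E.
Proof. by apply: nneseries_ge0 => j _ _; rewrite lee_fin divr_ge0 ?mulr_ge0// ltW. Qed.

End shell_weight.

Section shell_orthogonality.
Context {R : realType}.
Local Notation leb := (@lebesgue_measure R).

Lemma sin_2pi_nat (m : nat) : sin (2 * pi * m%:R : R) = 0.
Proof.
elim: m => [|m ih]; first by rewrite mulr0 sin0.
rewrite -(natr1 m) mulrDr mulr1 [X in _ + X]mulr_natl.
by have /= -> := sinD2pi (2 * pi * m%:R : R).
Qed.

Variables (r : R).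
Hypothesis r0 : 0 < r.
Local Notation W := (shell_weight r).
Local Notation mass := (fine (shell_mass r)).

Lemma shell_mass_fin_num : shell_mass r \is a fin_num.
Proof.
by rewrite ge0_fin_numE ?shell_mass_ge0//; apply: le_lt_trans (shell_mass_le r0) (ltry _).
Qed.

Lemma integral_shell_weight : (\int[leb]_x (W x)%:E = shell_mass r)%E.
Proof.
rewrite -(ge0_integral_shell_weight r0 (g := cst 1))//.
- by apply: eq_integral => x _; rewrite mulr1.
- exact: cst_continuous.
- move=> j; rewrite Rintegral_cst//=.
  rewrite mul1r lebesgue_measure_itv/= lte_fin.
  case: ltP => jr; rewrite /=; first by rewrite opprK; ring.
  have : 0 <= j%:R * r by rewrite mulr_ge0// ltW.
  by move: jr; lra.
Qed.

Lemma integrable_shell_weight : leb.-integrable setT (EFin \o W).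
Proof.
apply/integrableP; split.
  by apply/measurable_EFinP; exact: measurable_shell_weight.
under eq_integral => x _ do rewrite /= ger0_norm ?(ltW (shell_weight_gt0 _ _))//.
by rewrite integral_shell_weight -ge0_fin_numE ?shell_mass_fin_num// shell_mass_ge0.
Qed.

Lemma Rintegral_shell_weight : \int[leb]_x W x = mass.
Proof. by rewrite /Rintegral integral_shell_weight. Qed.

(** [g] changes sign, but [1 + g] is nonnegative and has the same weighted integral as 1;
    subtracting the mass leaves zero. *)
Lemma Rintegral_shell_weight_annul (g : R -> R) : continuous g ->
  (forall x, `|g x| <= 1) ->
  (forall j : nat, (0 < j)%N ->
    \int[leb]_(x in `[- (j%:R * r), j%:R * r]) (1 + g x) = 2 * (j%:R * r)) ->
  leb.-integrable setT (EFin \o (fun x => W x * g x)) /\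
  \int[leb]_x (W x * g x) = 0.
Proof.
move=> cg g1 gE.
have mW := measurable_shell_weight r0.
have mg : measurable_fun setT g by exact: continuous_measurable_fun.
have W0 x : 0 <= W x by rewrite ltW// shell_weight_gt0.
have iWg : leb.-integrable setT (EFin \o (fun x => W x * g x)).
  apply: (le_integrable measurableT _ _ integrable_shell_weight).
    by apply/measurable_EFinP; exact: measurable_funM.
  by move=> x _ /=; rewrite lee_fin normrM (ger0_norm (W0 x)) ler_piMr.
split=> //.
have h1 := ge0_integral_shell_weight r0 (g := fun x => 1 + g x).
have : (\int[leb]_x (W x * (1 + g x))%:E = shell_mass r)%E.
  apply: h1.
  - apply: continuous_addf => //; exact: cst_continuous.
  - by move=> x; have := g1 x; rewrite ler_norml; lra.
  - case=> [|j]; last exact: gE.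
    by rewrite !(mul0r, oppr0, mulr0) set_itv1 Rintegral_set1.
under eq_integral do rewrite mulrDr mulr1.
move=> /(congr1 fine); rewrite -/(Rintegral _ _ _) RintegralD//;
    last exact: integrable_shell_weight.
by rewrite Rintegral_shell_weight; lra.
Qed.

(** The primitive of [1 + cos(z x)] is [x + sin(z x) / z], and the assumption on [z] kills the sine
    at the endpoints [j r] and [- j r]. *)
Lemma Rintegral_shell_weight_cos (z : R) : z != 0 ->
  (forall j : nat, sin (z * (j%:R * r)) = 0) ->
  leb.-integrable setT (EFin \o (fun x => W x * cos (z * x))) /\
  \int[leb]_x (W x * cos (z * x)) = 0.
Proof.
move=> z0 zj; apply: Rintegral_shell_weight_annul; first exact: continuous_cosM.
  by move=> x; rewrite ler_norml cos_geN1 cos_le1.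
move=> j j0.
have dF (x : R) : is_derive x (1:R) (fun x => x + z^-1 * sin (z * x)) (1 + cos (z * x)).
  have := is_deriveD (is_derive_id x (1:R)) (is_deriveZ z^-1 (is_derive_sinM z x)).
  by move=> h; apply: (is_derive_eq h); rewrite /GRing.scale/= mulKf.
rewrite (Rintegral_is_derive _ dF).
- by rewrite mulrN sinN zj; lra.
- by have : 0 < j%:R * r; [rewrite mulr_gt0// ltr0n|lra].
- by apply: continuous_addf; [exact: cst_continuous|exact: continuous_cosM].
Qed.

(** Here the boundary terms at [j r] and [- j r] cancel because the cosine is even. *)
Lemma Rintegral_shell_weight_sin (z : R) : z != 0 ->
  leb.-integrable setT (EFin \o (fun x => W x * sin (z * x))) /\
  \int[leb]_x (W x * sin (z * x)) = 0.
Proof.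
move=> z0; apply: Rintegral_shell_weight_annul; first exact: continuous_sinM.
  by move=> x; rewrite ler_norml sin_geN1 sin_le1.
move=> j j0.
have dF (x : R) : is_derive x (1:R) (fun x => x + (- z^-1) * cos (z * x)) (1 + sin (z * x)).
  have := is_deriveD (is_derive_id x (1:R)) (is_deriveZ (- z^-1) (is_derive_cosM z x)).
  by move=> h; apply: (is_derive_eq h); rewrite /GRing.scale/= mulrNN mulKf.
rewrite (Rintegral_is_derive _ dF).
- by rewrite mulrN cosN; lra.
- by have : 0 < j%:R * r; [rewrite mulr_gt0// ltr0n|lra].
- by apply: continuous_addf; [exact: cst_continuous|exact: continuous_sinM].
Qed.

End shell_orthogonality.

Section shell_characters.
Context {R : realType}.
Local Notation leb := (@lebesgue_measure R).
Variable delta : R.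
Hypothesis delta0 : 0 < delta.
Local Notation r := (2 * pi / delta).

Lemma shell_radius_gt0 : 0 < r.
Proof. by rewrite divr_gt0// mulr_gt0// pi_gt0. Qed.

(** The integrand of an entry of the Gram matrix of the one-dimensional characters for the shell
    weight. *)
Definition shell_character (k l : nat) (x : R) : R[i] :=
  (shell_weight r x)%:C%C *
    (expNi (delta * k%:R * x) * (expNi (delta * l%:R * x))^*%C).

(** Off the diagonal the frequency is [z = delta * (k - l)], and since [r = 2 pi / delta] every
    [z * j * r] is an integer multiple of [2 pi]. *)
Lemma cintegral_shell_character (k l : nat) :
  cintegrable leb (shell_character k l) /\
  cintegral leb (shell_character k l) =
    if k == l then (fine (shell_mass r))%:C%C else 0.
Proof.
have r0 := shell_radius_gt0.
pose z := delta * (k%:R - l%:R).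
have ReE : (fun x => complex.Re (shell_character k l x)) =
    (fun x => shell_weight r x * cos (z * x)).
  apply/funext => x; rewrite /shell_character /expNi /= !mul0r !subr0 opprK.
  by congr *%R; rewrite /z mulrBr mulrBl cosB; ring.
have ImE : (fun x => complex.Im (shell_character k l x)) =
    (fun x => -1 * (shell_weight r x * sin (z * x))).
  apply/funext => x; rewrite /shell_character /expNi /= !mul0r !addr0 opprK.
  by rewrite mulrCA; congr *%R; rewrite /z mulrBr mulrBl sinB; ring.
rewrite /cintegrable /cintegral ReE ImE.
have [kl|kl] := eqVneq k l.
  have z0 : z = 0 by rewrite /z kl subrr mulr0.
  have -> : (fun x => shell_weight r x * cos (z * x)) = shell_weight r.
    by apply/funext => x; rewrite z0 mul0r cos0 mulr1.
  have -> : (fun x => -1 * (shell_weight r x * sin (z * x))) = cst 0.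
    by apply/funext => x; rewrite z0 mul0r sin0 !mulr0.
  split; first by split; [exact: integrable_shell_weight|exact: integrable0].
  by rewrite Rintegral_shell_weight// /Rintegral integral0.
have z0 : z != 0.
  by rewrite /z mulf_eq0 negb_or gt_eqF//= subr_eq0 eqr_nat.
have zj (j : nat) : sin (z * (j%:R * r)) = 0.
  have -> : z * (j%:R * r) = 2 * pi * (k * j)%:R - 2 * pi * (l * j)%:R.
    by rewrite /z !natrM; field; rewrite gt_eqF.
  by rewrite sinB !sin_2pi_nat mul0r mulr0 subrr.
have [ic c0] := Rintegral_shell_weight_cos r0 z0 zj.
have [isn s0] := Rintegral_shell_weight_sin r0 z0.
split; first by split => //; exact: EFin_integrableZl.
by rewrite c0 RintegralZl// s0 mulr0.
Qed.

End shell_characters.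

(** * Sobolev norm of combinations of bumps *)

Section bump_combination.
Context {R : realType}.
Variables (d s N : nat) (delta : R).
Hypothesis delta0 : 0 < delta.
Local Notation K := {ffun 'I_d -> 'I_N}.
Local Notation leb := (@lebesgue_measure R).
Local Notation r := (2 * pi / delta).

Definition bump_prod (k : K) (x : euclidean R d) : R :=
  \prod_(i < d) bump s (tnth x i / delta - (k i)%:R).

Definition bump_comb (a : K -> R) (x : euclidean R d) : R :=
  \sum_k a k * bump_prod k x.

Definition character_comb (a : K -> R) (xi : euclidean R d) : R[i] :=
  \sum_k (a k)%:C%C * \prod_(i < d) expNi (delta * (k i)%:R * tnth xi i).

Lemma expNi_sum n (t : 'I_n -> R) :
  expNi (\sum_(i < n) t i) = \prod_(i < n) expNi (t i).
Proof.
elim: n t => [|n ih] t; first by rewrite !big_ord0 /expNi cos0 sin0 oppr0.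
rewrite !big_ord_recl -ih /expNi.
by apply/eqP; rewrite eq_complex /= cosD sinD mulrNN; apply/andP; split; apply/eqP; ring.
Qed.

(** The bumps are translates of a single one, so their transforms differ by phases only: the common
    factor comes out and the coefficients survive in a trigonometric polynomial. *)
Lemma fourier_bump_comb (a : K -> R) (xi : euclidean R d) :
  fourier (bump_comb a) xi =
  \prod_(i < d) (delta%:C%C * bump_fourier s (delta * tnth xi i)) *
  character_comb a xi.
Proof.
pose F (k : K) i (x : R) : R[i] :=
  (bump s (x / delta - (k i)%:R))%:C%C * expNi (x * tnth xi i).
have FE (k : K) i := cintegral_bump_affine s (k i)%:R delta0 (tnth xi i).
have iF (k : K) := cintegral_power_measure_prod (mu := leb)
  (F := F k) (fun i => (FE k i).1).
transitivity (cintegral lebesgue (fun x : euclidean R d =>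
    \sum_k (a k)%:C%C * \prod_(i < d) F k i (tnth x i))).
  rewrite /fourier /Cintegral -/(cintegral lebesgue _); congr cintegral.
  apply/funext => x; rewrite /bump_comb rmorph_sum mulr_suml; apply: eq_bigr => k _.
  rewrite rmorphM -mulrA; congr *%R; rewrite /bump_prod rmorph_prod expNi_sum.
  by rewrite -big_split.
rewrite cintegral_sum; last first.
  by move=> k; apply: cintegrableZl; exact: (iF k).1.
rewrite /character_comb mulr_sumr; apply: eq_bigr => k _.
rewrite cintegralZl; last exact: (iF k).1.
rewrite [cintegral _ _](iF k).2 mulrCA; congr *%R.
rewrite -big_split /=; apply: eq_bigr => i _.
by rewrite [LHS](FE k i).2 mulrAC.
Qed.

Lemma normcM_sqr (x y : R[i]) :
  Normc.normc (x * y) ^+ 2 = Normc.normc x ^+ 2 * Normc.normc y ^+ 2.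
Proof. by rewrite Normc.normcM exprMn. Qed.

Lemma normc_prod_sqr (I : finType) (F : I -> R[i]) :
  Normc.normc (\prod_i F i) ^+ 2 = \prod_i Normc.normc (F i) ^+ 2.
Proof.
apply: (big_morph (fun x => Normc.normc x ^+ 2) normcM_sqr).
by rewrite Normc.normc1 expr1n.
Qed.

Lemma normc_sqrE (x : R[i]) : (Normc.normc x ^+ 2)%:C%C = x * x^*%C.
Proof. by rewrite -sqr_normc rmorphXn. Qed.

Lemma normc_bump_fourier z :
  Normc.normc (bump_fourier s z) ^+ 2 = sq_moment (@bump_poly R s) z.
Proof. by rewrite /= sqr_sqrtr ?addr_ge0 ?sqr_ge0// sqrrN. Qed.

Lemma normc_fourier_bump_comb (a : K -> R) (xi : euclidean R d) :
  Normc.normc (fourier (bump_comb a) xi) ^+ 2 =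
  (\prod_(i < d) (delta ^+ 2 * sq_moment (@bump_poly R s) (delta * tnth xi i))) *
  Normc.normc (character_comb a xi) ^+ 2.
Proof.
rewrite fourier_bump_comb normcM_sqr normc_prod_sqr; congr *%R.
apply: eq_bigr => i _; rewrite normcM_sqr normc_bump_fourier; congr *%R.
by rewrite /= expr0n addr0 sqr_sqrtr ?sqr_ge0.
Qed.

Lemma sum_le_prod n (y : 'I_n -> R) : (forall i, 0 <= y i) ->
  \sum_(i < n) y i <= \prod_(i < n) (1 + y i).
Proof.
(* The induction needs the stronger bound with the leading 1. *)
move=> y0; suff : 1 + \sum_(i < n) y i <= \prod_(i < n) (1 + y i).
  by apply: le_trans; rewrite lerDr.
elim: n y y0 => [|n ih] y y0; first by rewrite !big_ord0 addr0.
rewrite !big_ord_recl; set S := \sum_(i < n) _; set P := \prod_(i < n) _.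
have SP : 1 + S <= P by exact: ih.
have S0 : 0 <= S by exact: sumr_ge0.
by have := y0 ord0; nra.
Qed.

(** Majorizes the isotropic Sobolev weight by a tensor product, in the scaled variable [delta * xi],
    so that the weighted integral can be treated one coordinate at a time. *)
Lemma norm2_powR_le (xi : euclidean R d) :
  norm2 xi `^ (2 * s%:R) <=
  delta ^- (2 * s) * \prod_(i < d) (1 + (delta * tnth xi i) ^+ 2) ^+ s.
Proof.
rewrite -natrM powR_mulrn ?sqrtr_ge0// exprM sqr_sqrtr; last first.
  by apply: sumr_ge0 => i _; rewrite -expr2 sqr_ge0.
rewrite exprM -exprVn prodrXl -exprMn lerXn2r ?nnegrE//.
- by apply: sumr_ge0 => i _; rewrite -expr2 sqr_ge0.
- rewrite mulr_ge0 ?invr_ge0 ?sqr_ge0// prodr_ge0// => i _.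
  by rewrite addr_ge0 ?sqr_ge0.
rewrite -ler_pdivrMl ?invr_gt0 ?exprn_gt0// invrK.
apply: le_trans (sum_le_prod _); last by move=> i; rewrite sqr_ge0.
by rewrite mulr_sumr; apply: ler_sum => i _; rewrite exprMn -expr2.
Qed.

(** Expanding the squared modulus gives the Gram matrix of the characters for the product weight. It
    is diagonal: two distinct multi-indices differ in some coordinate, whose factor vanishes. *)
Lemma integral_shell_character_comb (a : K -> R) :
  let G := fun xi : euclidean R d => (\prod_(i < d) shell_weight r (tnth xi i)) *
     Normc.normc (character_comb a xi) ^+ 2 in
  lebesgue.-integrable setT (EFin \o G) /\
  (\int[lebesgue]_xi (G xi)%:E =
   (fine (shell_mass r) ^+ d * \sum_k a k ^+ 2)%:E)%E.
Proof.
move=> H; pose F (k l : K) i (x : R) := shell_character delta (k i) (l i) x.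
have FE (k l : K) i := cintegral_shell_character delta0 (k i) (l i).
have iF (k l : K) := cintegral_power_measure_prod (mu := leb)
  (F := F k l) (fun i => (FE k l i).1).
pose G (xi : euclidean R d) : R[i] := \sum_k \sum_l
    (a k * a l)%:C%C * \prod_(i < d) F k l i (tnth xi i).
have GE xi : G xi = (H xi)%:C%C.
  rewrite rmorphM [X in _ = _ * X]normc_sqrE rmorph_prod /character_comb.
  rewrite rmorph_sum mulr_suml mulr_sumr /G; apply: eq_bigr => k _.
  rewrite !mulr_sumr; apply: eq_bigr => l _.
  rewrite [X in _ * (_ * X)](_ : _ = (a l)%:C%C *
      \prod_(i < d) (expNi (delta * (l i)%:R * tnth xi i))^*%C); last first.
    by rewrite rmorphM rmorph_prod; congr *%R; exact: conjc_real.
  have regroup (x y w p q : R[i]) : w * (x * p * (y * q)) = x * y * (w * (p * q)).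
    by ring.
  rewrite regroup -!big_split /=; congr *%R.
  exact: (rmorphM (real_complex R)).
have iG1 k : cintegrable lebesgue (fun xi => \sum_l
    (a k * a l)%:C%C * \prod_(i < d) F k l i (tnth xi i)).
  by apply: cintegrable_sum => l; apply: cintegrableZl; exact: (iF k l).1.
have iG : cintegrable lebesgue G by exact: cintegrable_sum.
have intG : cintegral lebesgue G = (fine (shell_mass r) ^+ d * \sum_k a k ^+ 2)%:C%C.
  rewrite cintegral_sum// mulr_sumr rmorph_sum; apply: eq_bigr => k _.
  rewrite cintegral_sum; last first.
    by move=> l; apply: cintegrableZl; exact: (iF k l).1.
  rewrite (bigD1 k)//= big1 ?addr0; last first.
    move=> l lk; rewrite cintegralZl; last exact: (iF k l).1.
    rewrite [cintegral _ _](iF k l).2.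
    have [i kli] : exists i, k i != l i.
      by apply/existsP; move: lk; apply: contraNT => /existsPn kl; apply/eqP/ffunP => i;
        apply/eqP; rewrite eq_sym; apply/negPn/kl.
    rewrite (bigD1 i)//= [X in _ * (X * _)](_ : _ = 0) ?mul0r ?mulr0//.
    by rewrite [LHS](FE k l i).2 ifN.
  rewrite cintegralZl; last exact: (iF k k).1.
  rewrite [cintegral _ _](iF k k).2 [X in _ * X](eq_bigr (fun=> (fine (shell_mass r))%:C%C)).
    by rewrite prodr_const card_ord -rmorphXn -rmorphM mulrC expr2.
  by move=> i _; rewrite [LHS](FE k k i).2 eqxx.
have /(congr1 (@complex.Re R)) /= := intG.
have ReG : (fun xi => complex.Re (G xi)) = H.
  by apply/funext => xi; rewrite GE.
have iH : lebesgue.-integrable setT (EFin \o H) by case: iG; rewrite ReG.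
rewrite ReG /Rintegral => <-; split=> //; rewrite fineK//.
exact: integrable_fin_num.
Qed.

(* Applies to the Sobolev integrand without measurability of the Fourier transform. *)
Lemma ge0_integral_le_nonmeasurable d' (T : measurableType d')
    (mu : {measure set T -> \bar R}) (f g : T -> \bar R) :
  (forall x, 0 <= f x)%E -> (forall x, f x <= g x)%E ->
  (\int[mu]_x f x <= \int[mu]_x g x)%E.
Proof.
move=> f0 fg; have g0 x : (0 <= g x)%E by exact: le_trans (f0 x) (fg x).
rewrite !ge0_integralTE//; apply: le_ereal_sup => _ [h hf <-].
by exists h => // x; exact: le_trans (hf x) (fg x).
Qed.

(** Of the [s.+1] factors [1 + z ^ 2] in the decay hypothesis, [s] offset the Sobolev weight and the
    last one yields [(1 + z ^ 2)^-1], which the shell weight dominates. *)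
Lemma sobolev_bump_comb (a : K -> R) (B : R) : 0 < B ->
  (forall z, (1 + z ^+ 2) ^+ s.+1 * sq_moment (@bump_poly R s) z <= B) ->
  (\int[lebesgue]_xi (norm2 xi `^ (2 * s%:R) *
      Normc.normc (fourier (bump_comb a) xi) ^+ 2)%:E <=
   (delta ^- (2 * s) * (16 * pi * B * delta) ^+ d * \sum_k a k ^+ 2)%:E)%E.
Proof.
move=> B0 decay.
have r0 := shell_radius_gt0 delta0.
(* Per coordinate: 4 from [shell_weight_ge], [B] from the decay, [delta ^ 2] from the dilation. The
   mass, at most [2 r = 4 pi / delta], completes this to [16 pi B delta]. *)
pose C1 := delta ^- (2 * s) * (4 * B * delta ^+ 2) ^+ d.
have C10 : 0 <= C1.
  by rewrite mulr_ge0 ?invr_ge0 ?exprn_ge0 ?mulr_ge0 ?exprn_ge0// ltW.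
have pointwise (xi : euclidean R d) :
    norm2 xi `^ (2 * s%:R) * Normc.normc (fourier (bump_comb a) xi) ^+ 2 <=
    C1 * ((\prod_(i < d) shell_weight r (tnth xi i)) *
      Normc.normc (character_comb a xi) ^+ 2).
  rewrite normc_fourier_bump_comb mulrA [leRHS]mulrA ler_wpM2r ?sqr_ge0//.
  have sq0 z : 0 <= sq_moment (@bump_poly R s) z by rewrite addr_ge0 ?sqr_ge0.
  apply: le_trans (ler_wpM2r _ (norm2_powR_le xi)) _.
    by apply: prodr_ge0 => i _; rewrite mulr_ge0 ?sqr_ge0.
  rewrite /C1 -[leLHS]mulrA -[leRHS]mulrA ler_wpM2l ?invr_ge0 ?exprn_ge0 ?(ltW delta0)//.
  rewrite -[X in _ <= _ ^+ X * _](card_ord d) -prodr_const -!big_split/=.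
  apply: ler_prod => i _; set y := delta * tnth xi i.
  apply/andP; split; first by rewrite mulr_ge0 ?exprn_ge0 ?addr_ge0 ?sqr_ge0// mulr_ge0
      ?sqr_ge0.
  have y1 : 0 < 1 + y ^+ 2 by rewrite ltr_pwDl ?sqr_ge0.
  have W1 : (1 + y ^+ 2)^-1 <= 4 * shell_weight r (tnth xi i).
    apply: shell_weight_ge => //.
    rewrite mulrC divfK ?gt_eqF//; have := @pi_ge2 R; lra.
  rewrite mulrCA (_ : 4 * B * _ * _ = delta ^+ 2 * (B * (4 * shell_weight r (tnth xi i))));
      last by ring.
  rewrite ler_wpM2l ?sqr_ge0//.
  apply: le_trans (ler_wpM2l (ltW B0) W1).
  by rewrite ler_pdivlMr// mulrC mulrA -exprS.
apply: (@le_trans _ _ (\int[lebesgue]_xi (C1%:E * ((\prod_(i < d) shell_weight r (tnth xi i)) *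
      Normc.normc (character_comb a xi) ^+ 2)%:E))%E).
  apply: ge0_integral_le_nonmeasurable => xi.
    by rewrite lee_fin mulr_ge0 ?powR_ge0 ?sqr_ge0.
  by rewrite -EFinM lee_fin; exact: pointwise.
have [iG GE] := integral_shell_character_comb a.
rewrite ge0_integralZl//; last 2 first.
- exact: measurable_int iG.
- move=> xi _; rewrite lee_fin mulr_ge0 ?sqr_ge0// prodr_ge0// => i _.
  by rewrite ltW// shell_weight_gt0.
rewrite [X in (_ * X)%E]GE -EFinM lee_fin /C1 [leLHS]mulrA.
rewrite ler_wpM2r ?sumr_ge0// => [i _|]; first by rewrite sqr_ge0.
have m0 : 0 <= fine (shell_mass r) by rewrite fine_ge0// shell_mass_ge0.
have m1 : fine (shell_mass r) <= 2 * r.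
  by rewrite -lee_fin fineK ?shell_mass_fin_num// shell_mass_le.
rewrite -[leLHS]mulrA ler_wpM2l ?invr_ge0 ?exprn_ge0 ?(ltW delta0)// -exprMn lerXn2r ?nnegrE.
- by [].
- by rewrite !mulr_ge0 ?sqr_ge0// ltW.
- by rewrite !mulr_ge0 ?pi_ge0// ltW.
apply: le_trans (ler_wpM2l _ m1) _; first by rewrite !mulr_ge0 ?sqr_ge0// ltW.
by rewrite le_eqVlt; apply/orP; left; apply/eqP; field; rewrite gt_eqF.
Qed.

End bump_combination.

(** * Measures given by a density *)

Section density_measure.
Context {d} {T : measurableType d} {R : realType}.
Variables (nu mu : {measure set T -> \bar R}) (g : T -> R).
Hypotheses (mg : measurable_fun setT g) (g0 : forall x, 0 <= g x).
Hypothesis nuE : forall A, measurable A -> (nu A = \int[mu]_(x in A) (g x)%:E)%E.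
Local Open Scope ereal_scope.
Import HBNNSimple.

Let nnsfun_density (h : {nnsfun T >-> R}) :
  \int[nu]_x (h x)%:E = \int[mu]_x ((h x)%:E * (g x)%:E).
Proof.
have mhg y : measurable_fun setT (fun x => (y * \1_(h @^-1` [set y]) x)%:E * (g x)%:E).
  apply: emeasurable_funM; last exact/measurable_EFinP.
  by apply/measurable_EFinP; exact: measurable_funM.
have h0 y x : 0 <= (y * \1_(h @^-1` [set y]) x)%:E.
  by rewrite EFinM; exact: nnfun_muleindic_ge0.
rewrite integralT_nnsfun sintegralE.
transitivity (\int[mu]_x \sum_(y \in range h) ((y * \1_(h @^-1` [set y]) x)%:E * (g x)%:E)).
  rewrite ge0_integral_fsum//; last first.
    by move=> y x _; apply: mule_ge0; rewrite ?h0 ?lee_fin.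
  apply: eq_fsbigr => y; rewrite inE => -[x _ <-].
  rewrite nuE// integral_mkcond -ge0_integralZl//; last 3 first.
  - by rewrite epatch_indic; apply: emeasurable_funM; apply/measurable_EFinP.
  - by move=> z _; rewrite erestrict_ge0// => ? _; rewrite lee_fin.
  - by rewrite lee_fin.
  apply: eq_integral => z _; rewrite epatch_indic /= EFinM -muleA.
  by rewrite [X in _ * X]muleC.
by apply: eq_integral => x _; rewrite [in RHS]fimfunE -fsumEFin// ge0_mule_fsuml//.
Qed.

(** From sets to functions: simple functions first, then monotone convergence on both sides. *)
Lemma has_density_integral : has_density nu mu g.
Proof.
split=> // F mF F0.
pose h := nnsfun_approx measurableT mF.
have hF x : EFin \o h ^~ x @ \oo --> F x by exact: cvg_nnsfun_approx.
have ndh x : {homo (fun n => h n x) : m n / (m <= n)%N >-> (m <= n)%R}.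
  by move=> m n mn; exact/lefP/nd_nnsfun_approx.
transitivity (limn (fun n => \int[nu]_x (h n x)%:E)).
  rewrite -monotone_convergence//.
  - by apply: eq_integral => x _; apply/esym/cvg_lim => //; exact: hF.
  - by move=> n; exact/measurable_EFinP.
  - by move=> n x _; rewrite lee_fin.
  - by move=> x _ m n mn; rewrite lee_fin ndh.
under eq_fun do rewrite nnsfun_density.
rewrite -monotone_convergence//.
- apply: eq_integral => x _; apply/cvg_lim => //.
  by apply: cvgeZr => //; exact: hF.
- by move=> n; apply: emeasurable_funM; exact/measurable_EFinP.
- by move=> n x _; rewrite mule_ge0 ?lee_fin.
- by move=> x _ m n mn; rewrite lee_wpmul2r ?lee_fin ?ndh.
Qed.

End density_measure.

Lemma has_density_density {R : realType} {d : nat} (f0 f1 : density R d)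
    (u : euclidean R d -> R) :
  measurable_fun setT u -> (forall x, 0 <= u x) ->
  (forall x, f1 x = f0 x * u x) ->
  has_density (density_prob f1) (density_prob f0) u.
Proof.
move=> mu u0 fE; split; [exact: mu|exact: u0|move=> F mF F0].
have dP (f : density R d) : has_density (density_prob f) lebesgue f.
  by apply: has_density_integral => //; [exact: measurable_density|exact: density_ge0].
have [_ _ ->//] := dP f1; have [_ _ ->//] := dP f0; last 2 first.
- by apply: emeasurable_funM => //; exact/measurable_EFinP.
- by move=> x; rewrite mule_ge0// lee_fin.
by apply: eq_integral => x _; rewrite fE mulrC EFinM muleA.
Qed.

(** * Integrals and pointwise bounds of combinations of disjoint bumps *)

Section bump_comb_properties.
Context {R : realType}.
Variables (d s N : nat) (delta : R).
Hypothesis delta0 : 0 < delta.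
Hypothesis d0 : (0 < d)%N.
Local Notation K := {ffun 'I_d -> 'I_N}.
Local Notation leb := (@lebesgue_measure R).
Local Notation bprod := (bump_prod s delta).
Local Notation bcomb := (@bump_comb R d s N delta).

Lemma bump_disjoint (k l : nat) (t : R) : k != l ->
  bump s (t - k%:R) * bump s (t - l%:R) = 0.
Proof.
move=> kl; have [k01|/bump_out->] := boolP (0 < t - k%:R < 1); last by rewrite mul0r.
have [l01|/bump_out->] := boolP (0 < t - l%:R < 1); last by rewrite mulr0.
exfalso; move: kl k01 l01; rewrite neq_ltn => /orP[] kl /andP[k0 k1] /andP[l0 l1].
- have : k.+1%:R <= l%:R :> R by rewrite ler_nat.
  by rewrite -natr1; lra.
- have : l.+1%:R <= k%:R :> R by rewrite ler_nat.
  by rewrite -natr1; lra.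
Qed.

Lemma bump_prod_disjoint (k l : K) (x : euclidean R d) : k != l ->
  bprod k x * bprod l x = 0.
Proof.
move=> kl; have [i kli] : exists i, k i != l i.
  apply/existsP; move: kl; apply: contraNT => /existsPn kl.
  by apply/eqP/ffunP => i; apply/eqP/negPn/kl.
rewrite /bump_prod -big_split (bigD1 i)//= bump_disjoint ?mul0r//.
Qed.

Lemma bump_comb_mul (a b : K -> R) (x : euclidean R d) :
  bcomb a x * bcomb b x = \sum_k a k * b k * bprod k x ^+ 2.
Proof.
rewrite /bump_comb mulr_suml; apply: eq_bigr => k _.
rewrite mulr_sumr (bigD1 k)//= big1 ?addr0 => [|l lk].
  by rewrite expr2 mulrACA.
by rewrite mulrACA bump_prod_disjoint ?mulr0// eq_sym.
Qed.

(** At most one bump is nonzero at a given point, so pointwise bounds on a combination do not grow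
    with the number of cells. *)
Lemma bump_comb_single (a : K -> R) (x : euclidean R d) :
  bcomb a x = 0 \/ exists2 k, bprod k x != 0 & bcomb a x = a k * bprod k x.
Proof.
have [[k kx]|] := pselect (exists k : K, bprod k x != 0).
  right; exists k => //; rewrite /bump_comb (bigD1 k)//= big1 ?addr0// => l lk.
  have /eqP := bump_prod_disjoint x lk.
  by rewrite mulf_eq0 (negbTE kx) orbF => /eqP ->; rewrite mulr0.
move=> /forallNP h; left; rewrite /bump_comb big1// => k _.
by have /negP/negPn/eqP -> := h k; rewrite mulr0.
Qed.

Lemma measurable_bump_prod (k : K) : measurable_fun setT (bprod k).
Proof.
rewrite /bump_prod.
apply: (@measurable_tnth_prod _ (measurableTypeR R) R d (fun i x =>
    bump s (x / delta - (k i)%:R))) => i.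
apply: (measurableT_comp (measurable_bump s)).
by apply: measurable_funB => //; exact: measurable_funM.
Qed.

Lemma measurable_bump_comb (a : K -> R) : measurable_fun setT (bcomb a).
Proof.
apply: measurable_sum => k; apply: measurable_funM => //.
exact: measurable_bump_prod.
Qed.

Lemma bump_prod_bound B (k : K) (x : euclidean R d) :
  (forall t, `|bump s t| <= B) -> `|bprod k x| <= B ^+ d.
Proof.
move=> bB; rewrite /bump_prod normr_prod -[X in _ <= _ ^+ X](card_ord d) -prodr_const.
by apply: ler_prod => i _; rewrite normr_ge0 bB.
Qed.

Lemma bump_prod_itv (k : K) (x : euclidean R d) (i : 'I_d) : bprod k x != 0 ->
  0 <= tnth x i <= delta * N%:R.
Proof.
rewrite /bump_prod => /prodf_neq0 /(_ i isT).
have [/andP[k0 k1] _|/bump_out->] := boolP (0 < tnth x i / delta - (k i)%:R < 1); last first.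
  by rewrite eqxx.
have kN : (k i).+1%:R <= N%:R :> R by rewrite ler_nat ltn_ord.
have k00 : 0 <= (k i)%:R :> R by [].
have -> : tnth x i = delta * (tnth x i / delta) by rewrite mulrC divfK// gt_eqF.
move: kN; rewrite -natr1 => kN.
by rewrite ler_pM2l// mulr_ge0 ?(ltW delta0)//=; lra.
Qed.

Lemma integral_bump_prod (k : K) :
  lebesgue.-integrable setT (EFin \o (bprod k : euclidean R d -> R)) /\
  \int[lebesgue]_x (bprod k x) = 0.
Proof.
(* The bumps change sign, which rules out the product formula for nonnegative functions; the complex
   one applies, with zero imaginary part. *)
pose F i (x : R) : R[i] := (bump s (x / delta - (k i)%:R))%:C%C.
have iF i : cintegrable leb (F i).
  split; first exact: integrable_bump_affine0.
  exact: integrable0.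
have F0 i : cintegral leb (F i) = 0.
  rewrite /cintegral [X in Complex X _](Rintegral_bump_affine0 s (k i)%:R delta0).
  by rewrite /Rintegral integral0.
have [[iRe _]] := cintegral_power_measure_prod (mu := leb) iF.
(* A coordinate exists because [d > 0], and a single vanishing factor is enough. *)
rewrite (bigD1 (Ordinal d0))//= F0 mul0r => /(congr1 (@complex.Re R)) /=.
have FE (t : euclidean R d) : \prod_(i < d) F i (tnth t i) = (bprod k t)%:C%C.
  by rewrite /bump_prod rmorph_prod.
have ReE : (fun t : euclidean R d => complex.Re (\prod_(i < d) F i (tnth t i))) = bprod k.
  by apply/funext => t; rewrite FE.
by move: iRe; rewrite ReE.
Qed.

Lemma ge0_integral_bump_prod_sqr (k : K) :
  (\int[lebesgue]_x (bprod k x ^+ 2)%:E =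
   ((delta * \int[leb]_(t in `[0, 1]) ((bump_poly s).[t] ^+ 2)) ^+ d)%:E)%E.
Proof.
pose F (i : 'I_d) (x : R) := bump s (x / delta - (k i)%:R) ^+ 2.
transitivity (\int[power_measure leb d]_t (\prod_(i < d) F i (tnth t i))%:E)%E.
  by apply: eq_integral => x _; rewrite /bump_prod prodrXl.
have iF i := integrable_bump_affine_sqr s (k i)%:R delta0.
rewrite ge0_integral_power_measure_prod; last 2 first.
- by move=> i; apply/measurable_EFinP; exact: measurable_int (iF i).
- by move=> i x; rewrite sqr_ge0.
rewrite (eq_bigr (fun=> (delta * \int[leb]_(t in `[0, 1]) ((bump_poly s).[t] ^+ 2))%:E)).
  by rewrite prodEFin prodr_const card_ord.
move=> i _; rewrite -(Rintegral_bump_affine_sqr s (k i)%:R delta0) /Rintegral fineK//.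
exact: (integrable_fin_num measurableT (iF i)).
Qed.

Lemma integral_bump_comb (a : K -> R) :
  lebesgue.-integrable setT (EFin \o bcomb a) /\ \int[lebesgue]_x (bcomb a x) = 0.
Proof.
have h (r : seq K) :
    lebesgue.-integrable setT (EFin \o (fun x => \sum_(k <- r) a k * bprod k x)) /\
    \int[lebesgue]_x (\sum_(k <- r) a k * bprod k x) = 0.
  elim: r => [|k r [ih1 ih2]].
    under eq_fun do rewrite big_nil.
    by split; [exact: integrable0|rewrite /Rintegral integral0].
  have [ik k0] := integral_bump_prod k.
  have ika := EFin_integrableZl (a k) ik.
  under eq_fun do rewrite big_cons.
  split; first exact: EFin_integrableD.
  by rewrite RintegralD// RintegralZl// k0 ih2 mulr0 addr0.
exact: h.
Qed.

Lemma ge0_integral_bump_comb_sqr (a : K -> R) :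
  (\int[lebesgue]_x (bcomb a x ^+ 2)%:E =
   ((\sum_k a k ^+ 2) *
     (delta * \int[leb]_(t in `[0, 1]) ((bump_poly s).[t] ^+ 2)) ^+ d)%:E)%E.
Proof.
under eq_integral do rewrite expr2 bump_comb_mul -sumEFin.
rewrite ge0_integral_sum//; last 2 first.
- move=> k; apply/measurable_EFinP; apply: measurable_funM => //.
  by apply: measurable_funX; exact: measurable_bump_prod.
- by move=> k x _; rewrite lee_fin mulr_ge0 ?sqr_ge0// -expr2 sqr_ge0.
rewrite mulr_suml -sumEFin; apply: eq_bigr => k _.
under eq_integral do rewrite EFinM.
rewrite ge0_integralZl_EFin//; last 3 first.
- by move=> x _; rewrite lee_fin sqr_ge0.
- by apply/measurable_EFinP; apply: measurable_funX; exact: measurable_bump_prod.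
- by rewrite -expr2 sqr_ge0.
by rewrite [X in (_ * X)%E]ge0_integral_bump_prod_sqr.
Qed.

End bump_comb_properties.

(** * Perturbations of a null pair *)

Lemma integral_Rintegral d (T : measurableType d) (R : realType)
    (mu : {measure set T -> \bar R}) (f : T -> R) (v : R) :
  mu.-integrable setT (EFin \o f) -> \int[mu]_x f x = v ->
  (\int[mu]_x (f x)%:E = v%:E)%E.
Proof.
move=> intf <-; rewrite /Rintegral fineK//.
exact: (integrable_fin_num measurableT intf).
Qed.

Lemma measurable_fun_invr d (T : measurableType d) (R : realType) (f : T -> R) :
  measurable_fun setT f -> (forall x, 0 <= f x) ->
  measurable_fun setT (fun x => (f x)^-1).
Proof.
move=> mf f0; rewrite (_ : (fun x => _) = (fun x => f x `^ (-1))).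
  exact: (measurableT_comp (measurable_powR (-1)) mf).
by apply/funext => x; rewrite powR_inv1.
Qed.

Section least_favorable_pair.
Context {R : realType} {d : nat}.
Local Notation X := (euclidean R d).
Variables (r : X -> R) (c C : R) (n m : nat).
Hypotheses (mr : measurable_fun setT r) (c0 : 0 < c) (rcC : forall x, c <= r x <= C).
Hypotheses (n0 : (0 < n)%N) (m0 : (0 < m)%N).
Variable base : density R d.

Local Notation kappa := (\int[lebesgue]_x (r x * base x)).
Local Notation lam := kappa^-1.
Local Notation weight_f := (m%:R / (n + m)%:R : R).
Local Notation weight_g := (n%:R / (n + m)%:R : R).

Lemma r_itv x : 0 <= r x <= C.
Proof. by have /andP[cr ->] := rcC x; rewrite (le_trans (ltW c0) cr). Qed.

Lemma le_cC : c <= C.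
Proof. by have /andP[] := rcC [tuple of nseq d 0]; exact: le_trans. Qed.

Lemma C_gt0 : 0 < C.
Proof. exact: lt_le_trans c0 le_cC. Qed.

Lemma integrable_density (f : density R d) : lebesgue.-integrable setT (EFin \o f).
Proof.
apply/integrableP; split; first by apply/measurable_EFinP; exact: measurable_density.
under eq_integral => x _ do rewrite /= ger0_norm ?density_ge0//.
by rewrite integral_density ltry.
Qed.

Lemma Rintegral_density (f : density R d) : \int[lebesgue]_x f x = 1.
Proof. by rewrite /Rintegral integral_density. Qed.

Lemma integrable_reweighted : lebesgue.-integrable setT (EFin \o (fun x => r x * base x)).
Proof.
have := EFin_integrableZl C (integrable_density base).
apply: le_integrable => //.
- by apply/measurable_EFinP; apply: measurable_funM => //; exact: measurable_density.
- move=> x _ /=; have /andP[r0 rleC] := r_itv x.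
  by rewrite lee_fin !normrM ler_wpM2r// (ger0_norm r0) ger0_norm// (le_trans r0).
Qed.

Lemma kappa_ge : c <= kappa.
Proof.
rewrite -[c]mulr1 -(Rintegral_density base) -RintegralZl//; last exact: integrable_density.
apply: le_Rintegral => //.
- exact/EFin_integrableZl/integrable_density.
- exact: integrable_reweighted.
- by move=> x _; rewrite ler_wpM2r ?density_ge0//; case/andP: (rcC x).
Qed.

Lemma kappa_le : kappa <= C.
Proof.
rewrite -[leRHS]mulr1 -(Rintegral_density base) -RintegralZl//; last exact: integrable_density.
apply: le_Rintegral => //.
- exact: integrable_reweighted.
- exact/EFin_integrableZl/integrable_density.
- by move=> x _; rewrite ler_wpM2r ?density_ge0//; case/andP: (rcC x).
Qed.

Lemma kappa_gt0 : 0 < kappa.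
Proof. exact: lt_le_trans c0 kappa_ge. Qed.

Lemma lam_gt0 : 0 < lam.
Proof. by rewrite invr_gt0 kappa_gt0. Qed.

Lemma lam_r_ge x : c / C <= lam * r x.
Proof.
have /andP[cr _] := rcC x.
rewrite mulrC ler_pM ?(ltW c0) ?invr_ge0 ?(ltW C_gt0)// lef_pV2 ?posrE ?kappa_gt0 ?C_gt0//.
exact: kappa_le.
Qed.

Lemma lam_r_le x : lam * r x <= C / c.
Proof.
have /andP[r0 rleC] := r_itv x.
rewrite mulrC ler_pM ?invr_ge0 ?(ltW kappa_gt0)// lef_pV2 ?posrE ?kappa_gt0//.
exact: kappa_ge.
Qed.

Lemma measurable_reweighted : measurable_fun setT (fun x => lam * r x * base x).
Proof.
apply: measurable_funM; last exact: measurable_density.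
exact: measurable_funM.
Qed.

Lemma lam_r_gt0 x : 0 < lam * r x.
Proof. by apply: lt_le_trans (lam_r_ge x); rewrite divr_gt0// C_gt0. Qed.

Lemma reweighted_ge0 x : 0 <= lam * r x * base x.
Proof. by rewrite mulr_ge0 ?density_ge0// ltW// lam_r_gt0. Qed.

Lemma Rintegral_reweighted : \int[lebesgue]_x (lam * r x * base x) = 1.
Proof.
under eq_Rintegral do rewrite -mulrA.
rewrite RintegralZl//; last exact: integrable_reweighted.
by rewrite mulVf// gt_eqF// kappa_gt0.
Qed.

Lemma integrable_lam_reweighted :
  lebesgue.-integrable setT (EFin \o (fun x => lam * r x * base x)).
Proof.
under eq_fun do rewrite -mulrA.
by apply: EFin_integrableZl; exact: integrable_reweighted.
Qed.

Lemma integral_reweighted : (\int[lebesgue]_x (lam * r x * base x)%:E = 1)%E.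
Proof.
exact: (integral_Rintegral integrable_lam_reweighted Rintegral_reweighted).
Qed.

Definition reweighted : density R d :=
  Density measurable_reweighted reweighted_ge0 integral_reweighted.

Lemma null_reweighted : null_hypothesis r (base, reweighted).
Proof. by apply/nearW => x /=; rewrite -mulrA mulrC. Qed.

Variable p : X -> R.
Hypotheses (mp : measurable_fun setT p).
Hypothesis p_le : forall x, `|p x| <= c / C * base x.
Hypothesis p_int0 : \int[lebesgue]_x p x = 0.

Lemma weight_f_itv : 0 <= weight_f <= 1.
Proof.
have nm : 0 < (n + m)%:R :> R by rewrite ltr0n addn_gt0 n0.
by rewrite divr_ge0// ler_pdivrMr// mul1r ler_nat leq_addl.
Qed.

Lemma weight_g_itv : 0 <= weight_g <= 1.
Proof.
have nm : 0 < (n + m)%:R :> R by rewrite ltr0n addn_gt0 n0.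
by rewrite divr_ge0// ler_pdivrMr// mul1r ler_nat leq_addr.
Qed.

Lemma cC_itv : 0 < c / C <= 1.
Proof. by rewrite divr_gt0 ?C_gt0//= ler_pdivrMr ?C_gt0// mul1r le_cC. Qed.

Lemma integrable_p : lebesgue.-integrable setT (EFin \o p).
Proof.
have := EFin_integrableZl (c / C) (integrable_density base).
apply: le_integrable => //; first exact/measurable_EFinP.
move=> x _ /=; rewrite lee_fin; apply: le_trans (p_le x) _; exact: ler_norm.
Qed.

Lemma perturbed_f_ge0 x : 0 <= base x + weight_f * p x.
Proof.
have /andP[w0 w1] := weight_f_itv; have /andP[cC0 cC1] := cC_itv.
have := p_le x; rewrite ler_norml => /andP[pl _].
have b0 := density_ge0 base x.
have pb : - base x <= p x by apply: le_trans pl; rewrite lerN2 ler_piMl.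
move: (m%:R / _) w0 w1 => w w0 w1; rewrite (_ : _ + _ =
    (1 - w) * base x + w * (p x + base x)); last ring.
by rewrite addr_ge0// mulr_ge0//; lra.
Qed.

(** The source of the factor [c / C] in the bound on [p]: since [kappa <= C], the null density of
    the second sample is at least [c / C * base]. *)
Lemma perturbed_g_ge0 x : 0 <= lam * r x * base x - weight_g * p x.
Proof.
have /andP[w0 w1] := weight_g_itv.
have := p_le x; rewrite ler_norml => /andP[_ pl].
have b0 := density_ge0 base x.
rewrite subr_ge0; apply: (@le_trans _ _ (weight_g * (c / C * base x))).
  by rewrite ler_wpM2l.
apply: (@le_trans _ _ (c / C * base x)).
  by rewrite ler_piMl// mulr_ge0// ltW//; case/andP: cC_itv.
by rewrite ler_wpM2r// lam_r_ge.
Qed.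

Lemma measurable_perturbed_f : measurable_fun setT (fun x => base x + weight_f * p x).
Proof.
by apply: measurable_funD; [exact: measurable_density|exact: measurable_funM].
Qed.

Lemma measurable_perturbed_g :
  measurable_fun setT (fun x => lam * r x * base x - weight_g * p x).
Proof.
by apply: measurable_funB; [exact: measurable_reweighted|exact: measurable_funM].
Qed.

Lemma integral_perturbed_f : (\int[lebesgue]_x (base x + weight_f * p x)%:E = 1)%E.
Proof.
have iwp := EFin_integrableZl weight_f integrable_p.
have i := EFin_integrableD (integrable_density base) iwp.
apply: (integral_Rintegral i).
rewrite (RintegralD measurableT (integrable_density base) iwp) Rintegral_density.
by rewrite RintegralZl ?p_int0 ?mulr0 ?addr0//; exact: integrable_p.
Qed.

Lemma integral_perturbed_g :
  (\int[lebesgue]_x (lam * r x * base x - weight_g * p x)%:E = 1)%E.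
Proof.
have iwp := EFin_integrableZl weight_g integrable_p.
have i := EFin_integrableB integrable_lam_reweighted iwp.
apply: (integral_Rintegral i).
rewrite (RintegralB measurableT integrable_lam_reweighted iwp) Rintegral_reweighted.
by rewrite RintegralZl ?p_int0 ?mulr0 ?subr0//; exact: integrable_p.
Qed.

Definition perturbed_f : density R d :=
  Density measurable_perturbed_f perturbed_f_ge0 integral_perturbed_f.

Definition perturbed_g : density R d :=
  Density measurable_perturbed_g perturbed_g_ge0 integral_perturbed_g.

Local Notation pool := (pooled r perturbed_f perturbed_g n m).

Lemma pooled_perturbed l x :
  pool l x = base x * ((n%:R + lam * m%:R * r x) / (n%:R + l * m%:R * r x)).
Proof.
rewrite /pooled mulrA; congr (_ / _); rewrite /=.
by move: ((n + m)%:R^-1) kappa^-1 => N L; ring.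
Qed.

Lemma pooled_lam x : pool lam x = base x.
Proof.
rewrite pooled_perturbed divff ?mulr1// gt_eqF// ltr_pwDl ?ltr0n//.
by rewrite mulr_ge0 ?mulr_ge0 ?(ltW lam_gt0)//; case/andP: (r_itv x).
Qed.

Lemma measurable_pooled l : 0 <= l -> measurable_fun setT (pool l).
Proof.
move=> l0; apply: measurable_funM.
  apply: measurable_funD; apply: measurable_funM => //.
    exact: measurable_perturbed_f.
  exact: measurable_perturbed_g.
apply: measurable_fun_invr.
  by apply: measurable_funD => //; exact: measurable_funM.
by move=> x; have /andP[r0 _] := r_itv x; rewrite addr_ge0 ?mulr_ge0.
Qed.

Lemma pooled_ge0 l x : 0 <= l -> 0 <= pool l x.
Proof.
move=> l0; have /andP[r0 _] := r_itv x.
by rewrite divr_ge0 ?addr_ge0 ?mulr_ge0 ?density_ge0.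
Qed.

(** For [l] other than [lam], the pooled density is [base] times a ratio that stays on one side of 1
    and away from it uniformly in [x], so its integral cannot be 1. *)
Lemma pooled_unique l : 0 < l -> (\int[lebesgue]_x (pool l x)%:E = 1)%E -> l = lam.
Proof.
move=> l0 intl.
(* A lower bound, uniform in [x], on the distance of the ratio from 1: [r] is replaced by [c] in the
   numerator and by [C] in the denominator. *)
pose theta := `|l - lam| * m%:R * c / (n%:R + l * m%:R * C).
have m1 : 0 < m%:R :> R by rewrite ltr0n.
have n1 : 0 < n%:R :> R by rewrite ltr0n.
have den0 : 0 < n%:R + l * m%:R * C.
  by rewrite addr_gt0// !mulr_gt0// C_gt0.
apply/eqP; rewrite -subr_eq0 -normr_eq0; apply/negPn/negP => ll.
have d0 : 0 < `|l - lam| by rewrite lt_neqAle eq_sym ll normr_ge0.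
have theta0 : 0 < theta by rewrite divr_gt0// !mulr_gt0.
have ratio x : (n%:R + lam * m%:R * r x) / (n%:R + l * m%:R * r x) =
    1 - (l - lam) * m%:R * r x / (n%:R + l * m%:R * r x).
  have /andP[r0 _] := r_itv x.
  have D : n%:R + l * m%:R * r x != 0.
    by rewrite gt_eqF// ltr_pwDl// !mulr_ge0// ltW.
  by move: kappa^-1 => L; field.
have step x : `|l - lam| * m%:R * r x / (n%:R + l * m%:R * r x) >= theta.
  have /andP[cr rleC] := rcC x.
  have r0 : 0 < r x by exact: lt_le_trans c0 cr.
  rewrite /theta ler_pM ?invr_ge0 ?mulr_ge0 ?(ltW c0) ?(ltW den0)//.
    by rewrite ler_wpM2l ?mulr_ge0.
  rewrite lef_pV2 ?posrE// ?lerD2l ?ler_wpM2l ?mulr_ge0 ?(ltW l0)//.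
  by rewrite addr_gt0// !mulr_gt0.
have mpl := measurable_pooled (ltW l0).
have ipool : lebesgue.-integrable setT (EFin \o pool l).
  apply/integrableP; split; first exact/measurable_EFinP.
  under eq_integral => x _ do rewrite /= ger0_norm ?pooled_ge0 ?(ltW l0)//.
  by rewrite intl ltry.
have Rpool : \int[lebesgue]_x (pool l x) = 1 by rewrite /Rintegral intl.
have ib t := EFin_integrableZl t (integrable_density base).
have [ltl|gtl] := ltP lam l.
- have : \int[lebesgue]_x (pool l x) <= \int[lebesgue]_x ((1 - theta) * base x).
    apply: le_Rintegral => // x _.
    rewrite pooled_perturbed mulrC ler_wpM2r ?density_ge0// ratio lerD2l lerN2.
    by have := step x; rewrite gtr0_norm// subr_gt0.
  rewrite Rpool RintegralZl//; last exact: integrable_density.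
  by rewrite Rintegral_density mulr1; lra.
- have : \int[lebesgue]_x ((1 + theta) * base x) <= \int[lebesgue]_x (pool l x).
    apply: le_Rintegral => // x _.
    rewrite pooled_perturbed [leRHS]mulrC ler_wpM2r ?density_ge0// ratio.
    by have := step x; rewrite ler0_norm ?subr_le0// !mulNr; lra.
  rewrite Rpool RintegralZl//; last exact: integrable_density.
  by rewrite Rintegral_density mulr1; lra.
Qed.

Lemma lambda0_perturbed : lambda0 r perturbed_f perturbed_g n m = lam.
Proof.
(* [xget] returns a solution rather than its default 0 as soon as one exists, and [lam] is one. *)
have ex : exists l, 0 < l /\ (\int[lebesgue]_x (pool l x)%:E = 1)%E.
  exists lam; split; first exact: lam_gt0.
  by under eq_integral do rewrite pooled_lam; rewrite integral_density.
have [l0 intl] := xgetPex 0 ex.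
exact: pooled_unique.
Qed.

Lemma psi_perturbed : psi r perturbed_f perturbed_g n m = p.
Proof.
apply/funext => x; rewrite /psi lambda0_perturbed pooled_lam /= addrAC subrr add0r.
have nm : (n + m)%:R != 0 :> R by rewrite pnatr_eq0 addn_eq0 negb_and -!lt0n n0.
have m1 : m%:R != 0 :> R by rewrite pnatr_eq0 -lt0n.
by move: ((n + m)%:R) nm => N nm; field; rewrite nm m1.
Qed.

End least_favorable_pair.

(** * Likelihood ratios of the perturbed pairs *)

Lemma ge0_integral_tensor d1 d2 (T1 : measurableType d1) (T2 : measurableType d2)
    (R : realType) (m1 : {sigma_finite_measure set T1 -> \bar R})
    (m2 : {sigma_finite_measure set T2 -> \bar R}) (f : T1 -> R) (g : T2 -> R) :
  measurable_fun setT f -> measurable_fun setT g ->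
  (forall x, 0 <= f x) -> (forall y, 0 <= g y) ->
  (\int[m1 \x m2]_z (f z.1 * g z.2)%:E =
   (\int[m1]_x (f x)%:E) * (\int[m2]_y (g y)%:E))%E.
Proof.
move=> mf mg f0 g0.
have mfg : measurable_fun setT (fun z : T1 * T2 => (f z.1 * g z.2)%:E).
  apply/measurable_EFinP; apply: measurable_funM.
    exact: (measurableT_comp mf measurable_fst).
  exact: (measurableT_comp mg measurable_snd).
rewrite fubini_tonelli1//; last by move=> z; rewrite lee_fin mulr_ge0.
rewrite -ge0_integralZr//; last 3 first.
- exact/measurable_EFinP.
- by move=> x _; rewrite lee_fin.
- by apply: integral_ge0 => y _; rewrite lee_fin.
apply: eq_integral => x _; rewrite /fubini_F -ge0_integralZl//; last 3 first.
- exact/measurable_EFinP.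
- by move=> y _; rewrite lee_fin.
- by rewrite lee_fin.
Qed.

Section likelihood.
Context {R : realType} {d : nat}.
Local Notation X := (euclidean R d).
Variables (r : X -> R) (c C H : R) (n m : nat).
Hypotheses (mr : measurable_fun setT r) (c0 : 0 < c) (rcC : forall x, c <= r x <= C).
Hypotheses (n0 : (0 < n)%N) (m0 : (0 < m)%N).
Variable base : density R d.
Hypothesis H0 : 0 < H.
Hypothesis base_le : forall x, base x <= H^-1.
Variables (E : Type) (p : E -> X -> R).
Hypotheses (mp : forall e, measurable_fun setT (p e)).
Hypothesis p_le : forall e x, `|p e x| <= c / C * base x.
Hypothesis p_int0 : forall e, \int[lebesgue]_x p e x = 0.
(* [H * p e] is the density of [p e] with respect to [base]. *)
Hypothesis p_base : forall e x, base x * (H * p e x) = p e x.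

Local Notation kappa := (\int[lebesgue]_x (r x * base x)).
Local Notation lam := kappa^-1.
Local Notation weight_f := (m%:R / (n + m)%:R : R).
Local Notation weight_g := (n%:R / (n + m)%:R : R).
Local Notation f e := (perturbed_f m c0 rcC n0 (mp e) (p_le e) (p_int0 e)).
Local Notation g e := (perturbed_g m mr c0 rcC n0 (mp e) (p_le e) (p_int0 e)).
Local Notation base' := (reweighted mr c0 rcC base).

(** [H * p e] stands for the quotient of [p e] by [base], which would be meaningless where [base]
    vanishes; in [ratio_g] the further factor comes from the null density [lam * r * base]. *)
Definition ratio_f e x := 1 + weight_f * (H * p e x).
Definition ratio_g e x := 1 - weight_g * (H * p e x) * (lam * r x)^-1.

Lemma scaled_p_le e x : `|H * p e x| <= c / C.
Proof.
have /andP[q0 _] := cC_itv c0 rcC.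
rewrite normrM (gtr0_norm H0) -ler_pdivlMl//.
apply: le_trans (p_le e x) _.
by rewrite [leRHS]mulrC ler_wpM2l// ltW.
Qed.

Lemma measurable_scaled_p e : measurable_fun setT (fun x => H * p e x).
Proof. exact: measurable_funM. Qed.

Lemma measurable_lam_r_inv : measurable_fun setT (fun x => (lam * r x)^-1).
Proof.
apply: measurable_fun_invr; first exact: measurable_funM.
by move=> x; rewrite ltW// (lam_r_gt0 mr c0 rcC).
Qed.

Lemma measurable_ratio_f e : measurable_fun setT (ratio_f e).
Proof.
apply: measurable_funD => //; apply: measurable_funM => //; exact: measurable_scaled_p.
Qed.

Lemma measurable_ratio_g e : measurable_fun setT (ratio_g e).
Proof.
apply: measurable_funB => //; apply: measurable_funM; last exact: measurable_lam_r_inv.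
by apply: measurable_funM => //; exact: measurable_scaled_p.
Qed.

Lemma ratio_f_ge0 e x : 0 <= ratio_f e x.
Proof.
have /andP[w0 w1] := @weight_f_itv R n m n0; have /andP[q0 q1] := cC_itv c0 rcC.
have := scaled_p_le e x; rewrite ler_norml => /andP[h _].
rewrite /ratio_f; have : -1 <= H * p e x by apply: le_trans h; rewrite lerN2.
move: (m%:R / _) (H * _) w0 w1 => w y w0 w1 y1.
have -> : 1 + w * y = (1 - w) + w * (y + 1) by ring.
by rewrite addr_ge0 ?mulr_ge0//; lra.
Qed.

Lemma ratio_g_ge0 e x : 0 <= ratio_g e x.
Proof.
have /andP[w0 w1] := @weight_g_itv R n m n0; have /andP[q0 q1] := cC_itv c0 rcC.
have lr0 := lam_r_gt0 mr c0 rcC base x.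
have lrq := lam_r_ge mr c0 rcC base x.
have := scaled_p_le e x; rewrite ler_norml => /andP[_ h].
rewrite /ratio_g subr_ge0 ler_pdivrMr// mul1r.
have [y0|y0] := leP 0 (H * p e x).
  by apply: le_trans lrq; apply: le_trans h; rewrite ler_piMl.
by apply: le_trans (ltW lr0); rewrite mulr_ge0_le0// ltW.
Qed.

Lemma perturbed_fE e x : f e x = base x * ratio_f e x.
Proof. by rewrite /ratio_f /= mulrDr mulr1 mulrCA p_base. Qed.

Lemma perturbed_gE e x : g e x = base' x * ratio_g e x.
Proof.
have lr0 := lam_r_gt0 mr c0 rcC base x.
rewrite /ratio_g /= -{1}(p_base e x); move: lr0; move: (lam) => l lr0.
have : l * r x != 0 by rewrite gt_eqF.
move: (H * p e x) (base x) (n%:R / _) => y b w.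
move: (l * r x) => q q0; by field.
Qed.

Local Notation P0 := (data_law base base' n m).
Local Notation P e := (data_law (f e) (g e) n m).

Definition likelihood e (z : n.-tuple X * m.-tuple X) : R :=
  (\prod_(i < n) ratio_f e (tnth z.1 i)) * (\prod_(j < m) ratio_g e (tnth z.2 j)).

Lemma has_density_likelihood e : has_density (P e) P0 (likelihood e).
Proof.
have df := has_density_power n (has_density_density (measurable_ratio_f e)
  (ratio_f_ge0 e) (perturbed_fE e)).
have dg := has_density_power m (has_density_density (measurable_ratio_g e)
  (ratio_g_ge0 e) (perturbed_gE e)).
exact: has_density_prod df dg.
Qed.

Lemma integral_density_prob (q : density R d) (F : X -> R) :
  measurable_fun setT F -> (forall x, 0 <= F x) ->
  (\int[density_prob q]_x (F x)%:E = \int[lebesgue]_x (F x * q x)%:E)%E.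
Proof.
move=> mF F0.
have [_ _ ->//] : has_density (density_prob q) lebesgue q.
  by apply: has_density_integral => //; [exact: measurable_density|exact: density_ge0].
exact/measurable_EFinP.
Qed.

Lemma integrable_pM e e' : lebesgue.-integrable setT (EFin \o (fun x => H * p e x * p e' x)).
Proof.
have := EFin_integrableZl (c / C) (integrable_p (mp e') (p_le e')).
apply: le_integrable => //.
  by apply/measurable_EFinP; apply: measurable_funM => //; exact: measurable_scaled_p.
move=> x _ /=; have /andP[q0 _] := cC_itv c0 rcC.
by rewrite lee_fin normrM [leRHS]normrM (gtr0_norm q0) ler_wpM2r// scaled_p_le.
Qed.

Lemma integrable_pM_lam e e' :
  lebesgue.-integrable setT (EFin \o (fun x => H * p e x * p e' x * (lam * r x)^-1)).
Proof.
have := EFin_integrableZl (C / c) (integrable_pM e e').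
apply: le_integrable => //.
  apply/measurable_EFinP; apply: measurable_funM; last exact: measurable_lam_r_inv.
  by apply: measurable_funM => //; exact: measurable_scaled_p.
move=> x _ /=; have lr0 := lam_r_gt0 mr c0 rcC base x.
rewrite lee_fin mulrC normrM [leRHS]normrM ler_wpM2r//.
rewrite !gtr0_norm ?invr_gt0 ?divr_gt0// ?(C_gt0 c0 rcC)//.
rewrite -[C / c]invrK invf_div lef_pV2 ?posrE ?divr_gt0 ?(C_gt0 c0 rcC)//.
exact: lam_r_ge.
Qed.

(** The first-order terms integrate to zero because the perturbations have mean zero; only the
    constant and the cross term remain. *)
Lemma integral_ratio_ff e e' :
  (\int[density_prob base]_x (ratio_f e x * ratio_f e' x)%:E =
   (1 + weight_f ^+ 2 * \int[lebesgue]_x (H * p e x * p e' x))%:E)%E.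
Proof.
have ip e1 := integrable_p (mp e1) (p_le e1).
have ib := integrable_density base.
rewrite integral_density_prob; last 2 first.
- by apply: measurable_funM; exact: measurable_ratio_f.
- by move=> x; rewrite mulr_ge0// ratio_f_ge0.
have FE x : ratio_f e x * ratio_f e' x * base x =
    base x + weight_f * p e x + (weight_f * p e' x + weight_f ^+ 2 * (H * p e x * p e' x)).
  transitivity (base x + weight_f * (base x * (H * p e x)) + (weight_f * (base x *
      (H * p e' x)) +
    weight_f ^+ 2 * (H * p e x * (base x * (H * p e' x))))); last by rewrite !p_base.
  by rewrite /ratio_f; ring.
under eq_integral do rewrite FE.
have i1 := EFin_integrableD ib (EFin_integrableZl weight_f (ip e)).
have i2 := EFin_integrableD (EFin_integrableZl weight_f (ip e'))
  (EFin_integrableZl (weight_f ^+ 2) (integrable_pM e e')).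
apply: integral_Rintegral; first exact: (EFin_integrableD i1 i2).
rewrite (RintegralD measurableT i1 i2).
rewrite (RintegralD measurableT ib (EFin_integrableZl weight_f (ip e))).
rewrite (RintegralD measurableT (EFin_integrableZl weight_f (ip e'))
  (EFin_integrableZl (weight_f ^+ 2) (integrable_pM e e'))).
rewrite !RintegralZl//; last exact: integrable_pM.
by rewrite !p_int0 Rintegral_density; ring.
Qed.

(** As for the first sample. The density [lam * r * base] cancels one of the two inverse factors of
    the cross term, so a single one is left. *)
Lemma integral_ratio_gg e e' :
  (\int[density_prob base']_x (ratio_g e x * ratio_g e' x)%:E =
   (1 + weight_g ^+ 2 * \int[lebesgue]_x (H * p e x * p e' x * (lam * r x)^-1))%:E)%E.
Proof.
have ip e1 := integrable_p (mp e1) (p_le e1).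
have ib := integrable_density base'.
rewrite integral_density_prob; last 2 first.
- by apply: measurable_funM; exact: measurable_ratio_g.
- by move=> x; rewrite mulr_ge0// ratio_g_ge0.
have FE x : ratio_g e x * ratio_g e' x * base' x =
    base' x - weight_g * p e x + (weight_g ^+ 2 * (H * p e x * p e' x *
        (lam * r x)^-1) - weight_g * p e' x).
  have : lam * r x != 0 by rewrite gt_eqF// (lam_r_gt0 mr c0 rcC).
  move=> q0; transitivity (base' x - weight_g * (base x * (H * p e x)) + (weight_g ^+ 2 *
      (H * p e x * (base x * (H * p e' x)) * (lam * r x)^-1) - weight_g * (base x *
          (H * p e' x)))).
    rewrite /ratio_g /=; move: (weight_g) (lam * r x) q0 => w q q0; by field.
  by rewrite !p_base.
under eq_integral do rewrite FE.
have i1 := EFin_integrableB ib (EFin_integrableZl weight_g (ip e)).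
have i2 := EFin_integrableB (EFin_integrableZl (weight_g ^+ 2) (integrable_pM_lam e e'))
  (EFin_integrableZl weight_g (ip e')).
apply: integral_Rintegral; first exact: (EFin_integrableD i1 i2).
rewrite (RintegralD measurableT i1 i2).
rewrite (RintegralB measurableT ib (EFin_integrableZl weight_g (ip e))).
rewrite (RintegralB measurableT (EFin_integrableZl (weight_g ^+ 2) (integrable_pM_lam e e'))
  (EFin_integrableZl weight_g (ip e'))).
rewrite !RintegralZl//; last exact: integrable_pM_lam.
by rewrite !p_int0 Rintegral_density; ring.
Qed.

Lemma integral_likelihood e e' :
  (\int[P0]_z (likelihood e z * likelihood e' z)%:E =
   ((1 + weight_f ^+ 2 * \int[lebesgue]_x (H * p e x * p e' x)) ^+ n *
    (1 + weight_g ^+ 2 * \int[lebesgue]_x (H * p e x * p e' x * (lam * r x)^-1)) ^+ m)%:E)%E.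
Proof.
pose F (i : 'I_n) x := ratio_f e x * ratio_f e' x.
pose G (j : 'I_m) x := ratio_g e x * ratio_g e' x.
have mF i : measurable_fun setT (F i) by apply: measurable_funM; exact: measurable_ratio_f.
have mG j : measurable_fun setT (G j) by apply: measurable_funM; exact: measurable_ratio_g.
have F0 i x : 0 <= F i x by rewrite mulr_ge0// ratio_f_ge0.
have G0 j x : 0 <= G j x by rewrite mulr_ge0// ratio_g_ge0.
transitivity (\int[P0]_z ((\prod_(i < n) F i (tnth z.1 i)) *
    (\prod_(j < m) G j (tnth z.2 j)))%:E)%E.
  by apply: eq_integral => z _; rewrite /likelihood mulrACA -!big_split.
rewrite (ge0_integral_tensor (power_measure (density_prob base) n)
  (power_measure (density_prob base') m)
  (f := fun t => \prod_(i < n) F i (tnth t i))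
  (g := fun t => \prod_(j < m) G j (tnth t j))); last 4 first.
- exact: measurable_tnth_prod.
- exact: measurable_tnth_prod.
- by move=> t; rewrite prodr_ge0.
- by move=> t; rewrite prodr_ge0.
rewrite (ge0_integral_power_measure_prod _ mF F0) (ge0_integral_power_measure_prod _ mG G0).
under eq_bigr do rewrite integral_ratio_ff.
under [X in (_ * X)%E]eq_bigr do rewrite integral_ratio_gg.
by rewrite !prodEFin !prodr_const !card_ord EFinM.
Qed.

End likelihood.

(** * Rademacher averages *)

Section rademacher.
Context {R : realType}.

Lemma expR_le_inv (w : R) : w < 1 -> expR w <= (1 - w)^-1.
Proof.
move=> w1; rewrite -[w in expR w]opprK expRN lef_pV2 ?posrE ?expR_gt0 ?subr_gt0//.
by rewrite (le_trans _ (expR_ge1Dx _)).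
Qed.

(** A crude form of [cosh w <= exp(w^2 / 2)]: the left side is at most [2 / (1 - w^2)], and
    [1 / (1 - w^2) <= 1 + 2 w^2] exactly in the range [w^2 <= 1/2], apart from [w^2 > 1]. *)
Lemma expR_add_opp_le (w : R) : w ^+ 2 <= 2^-1 ->
  expR w + expR (- w) <= 2 * expR (2 * w ^+ 2).
Proof.
move=> w2.
have wlt1 : w < 1 by rewrite ltNge; apply/negP => w1; move: w2; apply/negP; rewrite -ltNge;
    nra.
have wgtN1 : - w < 1 by rewrite ltNge; apply/negP => w1; move: w2; apply/negP;
    rewrite -ltNge; nra.
apply: (@le_trans _ _ (2 * (1 + 2 * w ^+ 2))); last first.
  by rewrite ler_pM2l// expR_ge1Dx.
apply: (@le_trans _ _ ((1 - w)^-1 + (1 - - w)^-1)).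
  by rewrite lerD ?expR_le_inv.
have d1 : 0 < 1 - w by lra.
have d2 : 0 < 1 - - w by lra.
have -> : (1 - w)^-1 + (1 - - w)^-1 = 2 / ((1 - w) * (1 - - w)).
  by field; rewrite !gt_eqF// -[w]opprK.
rewrite ler_pdivrMr ?mulr_gt0// -mulrA ler_peMr//.
have -> : (1 + 2 * w ^+ 2) * ((1 - w) * (1 - - w)) =
  1 + w ^+ 2 * (1 - 2 * w ^+ 2) by ring.
by rewrite lerDl mulr_ge0 ?sqr_ge0//; lra.
Qed.

Definition sign (b : bool) : R := (-1) ^+ b.

Lemma sign_sqr b : sign b * sign b = 1.
Proof. by case: b; rewrite /sign ?expr1 ?expr0 ?mulrNN mulr1. Qed.

(** For fixed [e] the products [e_k e'_k] again run over all sign vectors, so the sum over [e']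
    factorizes into terms [2 cosh(w k)], each bounded by the previous lemma. *)
Lemma rademacher_sum (K : finType) (w : K -> R) :
  (forall k, w k ^+ 2 <= 2^-1) ->
  \sum_(e : {ffun K -> bool}) \sum_(e' : {ffun K -> bool})
    expR (\sum_k sign (e k) * sign (e' k) * w k) <=
  #|{ffun K -> bool}|%:R ^+ 2 * expR (2 * \sum_k w k ^+ 2).
Proof.
move=> w2.
have inner (e : {ffun K -> bool}) :
    \sum_(e' : {ffun K -> bool}) expR (\sum_k sign (e k) * sign (e' k) * w k) <=
    #|{ffun K -> bool}|%:R * expR (2 * \sum_k w k ^+ 2).
  have -> : \sum_(e' : {ffun K -> bool}) expR (\sum_k sign (e k) * sign (e' k) * w k) =
      \prod_k \sum_b expR (sign (e k) * sign b * w k).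
    by rewrite bigA_distr_bigA; apply: eq_bigr => e' _; rewrite expR_sum.
  rewrite card_ffun card_bool natrX mulr_sumr expR_sum -prodr_const -big_split /=.
  apply: ler_prod => k _; rewrite sumr_ge0 => [|b _]; last exact: expR_ge0.
  rewrite big_bool /= (le_trans _ (expR_add_opp_le (w2 k)))//.
  by rewrite /sign; case: (e k); rewrite ?expr1 ?expr0 ?mulrNN ?mulN1r ?mul1r ?mulr1
      ?mulrN1 ?mulNr ?mul1r//= addrC.
apply: le_trans (ler_sum _ (fun e _ => inner e)) _.
by rewrite sumr_const -[X in X <= _]mulr_natl expr2 mulrA.
Qed.

End rademacher.

(** * The uniform density on a cube *)

Section cube_density.
Context {R : realType} {d : nat}.
Variable A : R.
Hypothesis A0 : 0 < A.
Local Notation leb := (@lebesgue_measure R).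

Definition cube_fun (x : euclidean R d) : R :=
  \prod_(i < d) (A^-1 * \1_(`[0, A]%classic : set R) (tnth x i)).

Lemma measurable_cube_fun : measurable_fun setT cube_fun.
Proof.
apply: (@measurable_tnth_prod _ (measurableTypeR R) R d
  (fun i x => A^-1 * \1_(`[0, A]%classic : set R) x)) => i.
by apply: measurable_funM.
Qed.

Lemma cube_fun_ge0 x : 0 <= cube_fun x.
Proof. by rewrite prodr_ge0// => i _; rewrite mulr_ge0// invr_ge0 ltW. Qed.

Lemma integral_cube_fun : (\int[lebesgue]_x (cube_fun x)%:E = 1)%E.
Proof.
rewrite [LHS](@ge0_integral_power_measure_prod _ (measurableTypeR R) R leb d
  (fun i x => A^-1 * \1_(`[0, A]%classic : set R) x)); last 2 first.
- by move=> i; exact: measurable_funM.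
- by move=> i x; rewrite mulr_ge0// invr_ge0 ltW.
rewrite big1// => i _; under eq_integral do rewrite EFinM.
rewrite ge0_integralZl//; last 2 first.
- exact/measurable_EFinP.
- by rewrite lee_fin invr_ge0 ltW.
rewrite [X in (_ * X)%E](_ : _ = A%:E); last first.
  rewrite integral_indic// setIT [LHS](lebesgue_measure_itv `[0, A]) /= lte_fin A0.
  by rewrite -EFinD subr0.
by rewrite -EFinM mulVf// gt_eqF.
Qed.

Definition cube_density : density R d :=
  Density measurable_cube_fun cube_fun_ge0 integral_cube_fun.

Lemma cube_fun_le x : cube_fun x <= (A ^+ d)^-1.
Proof.
rewrite -exprVn -[X in _ <= _ ^+ X](card_ord d) -prodr_const; apply: ler_prod => i _.
by rewrite mulr_ge0 ?invr_ge0 ?(ltW A0)//= ler_piMr ?invr_ge0 ?(ltW A0)// indicE lern1 leq_b1.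
Qed.

Lemma cube_fun_in (x : euclidean R d) : (forall i, 0 <= tnth x i <= A) ->
  cube_fun x = (A ^+ d)^-1.
Proof.
move=> xA; rewrite -exprVn -[X in _ = _ ^+ X](card_ord d) -prodr_const.
apply: eq_bigr => i _; rewrite indicE mem_set ?mulr1//=.
by rewrite in_itv/=; exact: xA.
Qed.

End cube_density.

(** * The hard family *)

Lemma Rintegral_sum_seq d (T : measurableType d) (R : realType)
    (mu : {measure set T -> \bar R}) (I : Type) (F : I -> T -> R) (l : seq I) :
  (forall i, mu.-integrable setT (EFin \o F i)) ->
  mu.-integrable setT (EFin \o (fun x => \sum_(i <- l) F i x)) /\
  \int[mu]_x (\sum_(i <- l) F i x) = \sum_(i <- l) \int[mu]_x F i x.
Proof.
move=> iF; elim: l => [|i l [ih1 ih2]].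
  under eq_fun do rewrite big_nil.
  by rewrite big_nil; split; [exact: integrable0|rewrite /Rintegral integral0].
under eq_fun do rewrite big_cons.
by rewrite big_cons -ih2; split; [exact: EFin_integrableD|rewrite RintegralD].
Qed.

Section hard_family.
Context {R : realType}.
Variables (d s N : nat) (A gamma : R).
Hypotheses (d0 : (0 < d)%N) (N0 : (0 < N)%N) (A0 : 0 < A) (gamma0 : 0 < gamma).
Local Notation X := (euclidean R d).
Local Notation K := {ffun 'I_d -> 'I_N}.
Local Notation E := {ffun K -> bool}.
Local Notation leb := (@lebesgue_measure R).
Local Notation delta := (A / N%:R).
Local Notation base := (cube_density (d := d) A0).
Local Notation H := (A ^+ d).
Local Notation mass := (\int[leb]_(t in `[0, 1]) ((bump_poly s).[t] ^+ 2)).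

Definition hard_psi (e : E) : X -> R :=
  bump_comb s delta (fun k : K => gamma * sign (e k)).

Lemma mesh_gt0 : 0 < delta.
Proof. by rewrite divr_gt0// ltr0n. Qed.

Lemma mesh_mulN : delta * N%:R = A.
Proof. by rewrite divfK// pnatr_eq0 -lt0n. Qed.

Lemma measurable_hard_psi e : measurable_fun setT (hard_psi e).
Proof. exact: measurable_bump_comb. Qed.

Lemma hard_psi_int0 e : \int[lebesgue]_x hard_psi e x = 0.
Proof. by have [] := integral_bump_comb s mesh_gt0 d0 (fun k : K => gamma * sign (e k)). Qed.

Lemma integrable_hard_psi e : lebesgue.-integrable setT (EFin \o hard_psi e).
Proof. by have [] := integral_bump_comb s mesh_gt0 d0 (fun k : K => gamma * sign (e k)). Qed.

Lemma base_in (k : K) (x : X) : bump_prod s delta k x != 0 -> base x = H^-1.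
Proof.
move=> kx; apply: cube_fun_in => i.
by have := bump_prod_itv mesh_gt0 i kx; rewrite mesh_mulN.
Qed.

Lemma hard_psi_base e x : base x * (H * hard_psi e x) = hard_psi e x.
Proof.
rewrite /hard_psi; have [->|[k kx _]] := bump_comb_single s delta (fun k : K =>
    gamma * sign (e k)) x.
  by rewrite !mulr0.
by rewrite (base_in kx) mulKf// expf_neq0// gt_eqF.
Qed.

Lemma hard_psi_le (B q : R) e x : (forall t, `|bump s t| <= B) ->
  gamma * B ^+ d <= q * H^-1 -> `|hard_psi e x| <= q * base x.
Proof.
move=> bB gB; have q0 : 0 <= q.
  have Bd : 0 <= B ^+ d by rewrite exprn_ge0// (le_trans _ (bB 0)).
  have : 0 <= q * H^-1 by apply: le_trans gB; rewrite mulr_ge0// ltW.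
  by rewrite pmulr_lge0// invr_gt0 exprn_gt0.
rewrite /hard_psi; have [->|[k kx ->]] := bump_comb_single s delta (fun k : K =>
    gamma * sign (e k)) x.
  by rewrite normr0 mulr_ge0// density_ge0.
rewrite (base_in kx); apply: le_trans gB.
rewrite !normrM (gtr0_norm gamma0) normr_sign mulr1 ler_pM2l//.
exact: bump_prod_bound.
Qed.

Lemma sum_coeff_sqr (e : E) :
  \sum_(k : K) (gamma * sign (e k)) ^+ 2 = gamma ^+ 2 * N%:R ^+ d.
Proof.
rewrite (eq_bigr (fun=> gamma ^+ 2)) => [|k _].
  by rewrite sumr_const card_ffun !card_ord -[LHS]mulr_natr natrX.
by rewrite exprMn [X in _ * X]expr2 sign_sqr mulr1.
Qed.

(** Each of the [N ^ d] cells contributes a multiple of [delta ^ d], so [N] cancels and the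
    separation depends on the grid through [gamma] only. *)
Lemma hard_psi_sqr e :
  (\int[lebesgue]_x (hard_psi e x ^+ 2)%:E = (gamma ^+ 2 * (A * mass) ^+ d)%:E)%E.
Proof.
rewrite ge0_integral_bump_comb_sqr ?mesh_gt0// sum_coeff_sqr -mulrA -exprMn.
by rewrite mulrA [N%:R * _]mulrC mesh_mulN.
Qed.

Lemma Lnorm2_hard_psi e :
  ('N[lebesgue]_2%:E[EFin \o hard_psi e] =
    (Num.sqrt (gamma ^+ 2 * (A * mass) ^+ d))%:E)%E.
Proof.
rewrite unlock.
have -> : (\int[lebesgue]_x (`|(EFin \o hard_psi e) x| `^ 2) =
    (gamma ^+ 2 * (A * mass) ^+ d)%:E)%E.
  rewrite -(hard_psi_sqr e); apply: eq_integral => x _ /=.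
  by rewrite powR_mulrn// real_normK ?num_real.
rewrite /= powR12_sqrt// mulr_ge0 ?sqr_ge0// exprn_ge0// mulr_ge0 ?(ltW A0)//.
by apply: Rintegral_ge0 => t _; exact: sqr_ge0.
Qed.

Lemma hard_psi_sobolev e (B L : R) : 0 < B -> 1 <= A -> 0 <= L ->
  (forall z, (1 + z ^+ 2) ^+ s.+1 * sq_moment (@bump_poly R s) z <= B) ->
  gamma ^+ 2 * N%:R ^+ (2 * s) * (8 * B * A) ^+ d <= L ^+ 2 ->
  sobolev_ball s%:R L (hard_psi e).
Proof.
move=> B0 A1 L0 decay small; split.
- exact/Lfun1_integrable/integrable_hard_psi.
- rewrite inE; apply/andP; split; rewrite inE/=.
    exact: measurable_hard_psi.
  by rewrite /finite_norm Lnorm2_hard_psi ltry.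
apply: (le_trans (sobolev_bump_comb mesh_gt0 (fun k : K => gamma * sign (e k)) B0 decay)).
rewrite sum_coeff_sqr lee_fin -mulrA [X in _ * X]mulrCA -exprMn.
(* Isolates the factor [(2 pi) ^ d] of the definition of the Sobolev ball, which then cancels. *)
rewrite (_ : 16 * pi * B * delta * N%:R = 2 * pi * (8 * B * A)); last first.
  by rewrite -[in RHS]mesh_mulN; ring.
have regroup (x y z w : R) : x * (y * (z * w)) = z * (x * y * w) by ring.
rewrite (exprMn d (2 * pi) (8 * B * A)) regroup.
rewrite ler_wpM2l ?exprn_ge0 ?mulr_ge0 ?pi_ge0//.
apply: le_trans small; rewrite ler_wpM2r ?exprn_ge0 ?mulr_ge0 ?(ltW B0) ?(ltW A0)//.
(* What is left is [delta^-1 = N / A <= N], which holds as [A >= 1]. *)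
rewrite mulrC ler_wpM2l ?sqr_ge0// -exprVn lerXn2r ?nnegrE ?invr_ge0 ?(ltW mesh_gt0)//.
by rewrite invf_div ler_piMr// invf_le1.
Qed.

Section second_moment.
Variables (r : X -> R) (c C B : R) (n m : nat).
Hypotheses (mr : measurable_fun setT r) (c0 : 0 < c) (rcC : forall x, c <= r x <= C).
Hypotheses (n0 : (0 < n)%N) (m0 : (0 < m)%N) (mn : (m <= n)%N).
Hypothesis bB : forall t, `|bump s t| <= B.
Hypothesis gB : gamma * B ^+ d <= c / C * H^-1.

Local Notation kappa := (\int[lebesgue]_x (r x * base x)).
Local Notation lam := kappa^-1.
Local Notation weight_f := (m%:R / (n + m)%:R : R).
Local Notation weight_g := (n%:R / (n + m)%:R : R).
Local Notation p_le := (fun e x => hard_psi_le e x bB gB).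
Local Notation f e := (perturbed_f m c0 rcC n0 (measurable_hard_psi e) (p_le e)
    (hard_psi_int0 e)).
Local Notation g e := (perturbed_g m mr c0 rcC n0 (measurable_hard_psi e) (p_le e)
    (hard_psi_int0 e)).
Local Notation base' := (reweighted mr c0 rcC base).

Local Notation bprod k x := (bump_prod s delta k x : R).

Lemma integrable_bprod_sqr (k : K) :
  lebesgue.-integrable setT (EFin \o (fun x => bprod k x ^+ 2)).
Proof.
apply/integrableP; split.
  by apply/measurable_EFinP; apply: measurable_funX; exact: measurable_bump_prod.
under eq_integral => x _ do rewrite /= ger0_norm ?sqr_ge0//.
by rewrite (ge0_integral_bump_prod_sqr s mesh_gt0) ltry.
Qed.

Lemma Rintegral_bprod_sqr (k : K) :
  \int[lebesgue]_x (bprod k x ^+ 2) = (delta * mass) ^+ d.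
Proof. by rewrite /Rintegral (ge0_integral_bump_prod_sqr s mesh_gt0). Qed.

(** Disjoint supports leave the diagonal terms only. The weight [w] is 1 for the first sample and
    [(lam * r)^-1] for the second. *)
Lemma hard_psi_cross (w : X -> R) (e e' : E) :
  (forall k : K, lebesgue.-integrable setT (EFin \o (fun x => bprod k x ^+ 2 * w x))) ->
  \int[lebesgue]_x (H * hard_psi e x * hard_psi e' x * w x) =
  \sum_k sign (e k) * sign (e' k) *
    (gamma ^+ 2 * H * \int[lebesgue]_x (bprod k x ^+ 2 * w x)).
Proof.
move=> iw.
have FE x : H * hard_psi e x * hard_psi e' x * w x = \sum_k
    (sign (e k) * sign (e' k) * (gamma ^+ 2 * H)) * (bprod k x ^+ 2 * w x).
  rewrite -[H * _ * _]mulrA bump_comb_mul mulr_sumr mulr_suml.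
  by apply: eq_bigr => k _; ring.
under eq_Rintegral do rewrite FE.
rewrite (Rintegral_sum_seq (mu := lebesgue) _ _).2 => [|k].
  by apply: eq_bigr => k _; rewrite RintegralZl// -[LHS]mulrA.
exact: EFin_integrableZl.
Qed.

Lemma integrable_bprod_sqr_lam (k : K) :
  lebesgue.-integrable setT (EFin \o (fun x => bprod k x ^+ 2 * (lam * r x)^-1)).
Proof.
have := EFin_integrableZl (C / c) (integrable_bprod_sqr k).
apply: le_integrable => //.
  apply/measurable_EFinP; apply: measurable_funM.
    by apply: measurable_funX; exact: measurable_bump_prod.
  exact: (measurable_lam_r_inv mr c0 rcC).
move=> x _ /=; have lr0 := lam_r_gt0 mr c0 rcC base x.
rewrite lee_fin mulrC !normrM ler_wpM2r//.
rewrite gtr0_norm ?invr_gt0// -normrM gtr0_norm ?divr_gt0 ?(C_gt0 c0 rcC)//.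
rewrite -[C / c]invrK invf_div lef_pV2 ?posrE ?divr_gt0 ?(C_gt0 c0 rcC)//.
exact: (lam_r_ge mr c0 rcC base x).
Qed.

Local Notation W := (n%:R * (1 + C / c) * (gamma ^+ 2 * (A * delta * mass) ^+ d)).

(** [W] bounds the coefficient of each [e_k e'_k] in the exponent: both samples contribute, the
    second with an extra [C / c], and [m <= n] merges them. Of the two bounds on [N ^ d * W ^ 2],
    the first puts the coefficients in the range of the hyperbolic cosine estimate and the second
    makes the second moment at most [1 + t ^ 2]. *)
Lemma hard_second_moment (alpha t : R)
    (phi : n.-tuple X * m.-tuple X -> R) :
  0 < t -> N%:R ^+ d * W ^+ 2 <= 2^-1 ->
  expR (2 * (N%:R ^+ d * W ^+ 2)) <= 1 + t ^+ 2 ->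
  measurable_fun setT phi -> (forall z, 0 <= phi z <= 1) ->
  (\int[data_law base base' n m]_z (phi z)%:E <= alpha%:E)%E ->
  exists e, ((1 - alpha - t)%:E <= \int[data_law (f e) (g e) n m]_z (1 - phi z)%:E)%E.
Proof.
move=> t0 W1 W2 mphi phi01 phia.
pose a (k : K) := weight_f ^+ 2 * (gamma ^+ 2 * H * \int[lebesgue]_x (bprod k x ^+ 2 * 1)).
pose b (k : K) := weight_g ^+ 2 * (gamma ^+ 2 * H * \int[lebesgue]_x (bprod k x ^+ 2 *
    (lam * r x)^-1)).
pose w k := n%:R * a k + m%:R * b k.
have base_le x : base x <= H^-1 by exact: cube_fun_le.
have H0 : 0 < H by rewrite exprn_gt0.
pose L := likelihood (n := n) (m := m) r H base hard_psi.
have hdL e : has_density (data_law (f e) (g e) n m) (data_law base base' n m) (L e).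
  exact: (has_density_likelihood m mr c0 rcC n0 H0 base_le measurable_hard_psi p_le
      hard_psi_int0 hard_psi_base).
have intLL e e' : (\int[data_law base base' n m]_z (L e z * L e' z)%:E <=
    (expR (\sum_k sign (e k) * sign (e' k) * w k))%:E)%E.
  (* Raising [1 + x <= exp x] to a power needs [1 + x >= 0]; this holds because the left side is an
     integral of a product of likelihood ratios. *)
  have ff0 : 0 <= 1 + weight_f ^+ 2 * \int[lebesgue]_x (H * hard_psi e x * hard_psi e' x).
    rewrite -lee_fin -(integral_ratio_ff m c0 rcC n0 H0 base_le measurable_hard_psi p_le
        hard_psi_int0 hard_psi_base).
    by apply: integral_ge0 => x _; rewrite lee_fin mulr_ge0//
        (ratio_f_ge0 m c0 rcC n0 H0 base_le p_le).
  have gg0 : 0 <= 1 + weight_g ^+ 2 * \int[lebesgue]_x (H * hard_psi e x * hard_psi e' x *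
      (lam * r x)^-1).
    rewrite -lee_fin -(integral_ratio_gg m mr c0 rcC n0 H0 base_le measurable_hard_psi p_le
        hard_psi_int0 hard_psi_base).
    by apply: integral_ge0 => x _; rewrite lee_fin mulr_ge0//
        (ratio_g_ge0 m mr c0 rcC n0 H0 base_le p_le).
  rewrite (integral_likelihood m mr c0 rcC n0 H0 base_le measurable_hard_psi p_le
      hard_psi_int0 hard_psi_base).
  rewrite lee_fin.
  have fE : weight_f ^+ 2 * \int[lebesgue]_x (H * hard_psi e x * hard_psi e' x) =
      \sum_k sign (e k) * sign (e' k) * a k.
    under eq_Rintegral do rewrite -[_ * hard_psi e' _]mulr1.
    rewrite (hard_psi_cross (w := cst 1)) => [|k].
      by rewrite mulr_sumr; apply: eq_bigr => k _; rewrite mulrCA.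
    by under eq_fun do rewrite mulr1; exact: integrable_bprod_sqr.
  have gE : weight_g ^+ 2 * \int[lebesgue]_x (H * hard_psi e x * hard_psi e' x *
      (lam * r x)^-1) =
      \sum_k sign (e k) * sign (e' k) * b k.
    rewrite (hard_psi_cross (w := fun x => (lam * r x)^-1));
        last exact: integrable_bprod_sqr_lam.
    by rewrite mulr_sumr; apply: eq_bigr => k _; rewrite mulrCA.
  rewrite fE in ff0 *; rewrite gE in gg0 *.
  have -> : \sum_k sign (e k) * sign (e' k) * w k =
      n%:R * (\sum_k sign (e k) * sign (e' k) * a k) + m%:R * (\sum_k sign (e k) * sign
          (e' k) * b k).
    by rewrite !mulr_sumr -big_split; apply: eq_bigr => k _; rewrite /w /=; ring.
  rewrite expRD !expRM_natl.
  by apply: ler_pM; rewrite ?exprn_ge0// lerXn2r ?nnegrE ?expR_ge0// expR_ge1Dx.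
apply: (second_moment_lower_bound (L := L)) => //.
  by apply/card_gt0P; exists [ffun=> true].
apply: (@le_trans _ _ (\sum_(e : E) \sum_(e' : E) (expR (\sum_k sign (e k) * sign
    (e' k) * w k))%:E)%E).
  by apply: lee_sum => e _; apply: lee_sum.
under eq_bigr do rewrite sumEFin.
rewrite sumEFin lee_fin.
pose V := gamma ^+ 2 * (A * delta * mass) ^+ d.
have mass0 : 0 <= mass by apply: Rintegral_ge0 => u _; exact: sqr_ge0.
have dm0 : 0 <= (delta * mass) ^+ d by rewrite exprn_ge0// mulr_ge0// ltW// mesh_gt0.
have VE : V = gamma ^+ 2 * H * (delta * mass) ^+ d.
  by rewrite /V -[A * delta * mass]mulrA exprMn mulrA.
have gH0 : 0 <= gamma ^+ 2 * H by rewrite mulr_ge0 ?sqr_ge0 ?(ltW H0).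
have V0 : 0 <= V by rewrite VE mulr_ge0.
have Cc0 : 0 <= C / c by rewrite divr_ge0 ?(ltW (C_gt0 c0 rcC)) ?(ltW c0).
have wf2 : 0 <= weight_f ^+ 2 <= 1.
  by have /andP[w0 w1] := @weight_f_itv R n m n0; rewrite sqr_ge0/= expr_le1.
have wg2 : 0 <= weight_g ^+ 2 <= 1.
  by have /andP[w0 w1] := @weight_g_itv R n m n0; rewrite sqr_ge0/= expr_le1.
have aV k : 0 <= a k <= V.
  have -> : a k = weight_f ^+ 2 * V.
    by rewrite VE -(Rintegral_bprod_sqr k) /a; under eq_Rintegral do rewrite mulr1.
  by have /andP[w0 w1] := wf2; rewrite mulr_ge0//= ler_piMl.
have bV k : 0 <= b k <= V * (C / c).
  have /andP[w0 w1] := wg2.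
  have I0 : 0 <= \int[lebesgue]_x (bprod k x ^+ 2 * (lam * r x)^-1).
    apply: Rintegral_ge0 => x _; rewrite mulr_ge0 ?sqr_ge0// invr_ge0.
    exact/ltW/(lam_r_gt0 mr c0 rcC base x).
  have I1 : \int[lebesgue]_x (bprod k x ^+ 2 * (lam * r x)^-1) <= C / c * (delta * mass) ^+ d.
    rewrite -(Rintegral_bprod_sqr k) -RintegralZl//; last exact: integrable_bprod_sqr.
    apply: le_Rintegral => //.
    - exact: integrable_bprod_sqr_lam.
    - exact/EFin_integrableZl/integrable_bprod_sqr.
    move=> x _; rewrite [leRHS]mulrC ler_wpM2l ?sqr_ge0//.
    rewrite -[C / c]invrK invf_div lef_pV2 ?posrE ?divr_gt0 ?(C_gt0 c0 rcC)//.
      exact: (lam_r_ge mr c0 rcC base x).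
    exact: (lam_r_gt0 mr c0 rcC base x).
  rewrite mulr_ge0 ?(mulr_ge0 gH0)//=.
  apply: le_trans (ler_piMl _ w1) _; first by rewrite mulr_ge0.
  by rewrite VE -[leRHS]mulrA ler_wpM2l// [leRHS]mulrC.
have wW k : 0 <= w k <= W.
  have /andP[a0 a1] := aV k; have /andP[b0 b1] := bV k.
  apply/andP; split; first by apply: addr_ge0; [exact: mulr_ge0|exact: mulr_ge0].
  rewrite /w -/V mulrAC [_ * V * _]mulrDr mulr1 lerD//.
    by rewrite ler_wpM2l.
  rewrite -mulrA; apply: ler_pM => //.
  by rewrite ler_nat.
have w2 k : w k ^+ 2 <= W ^+ 2.
  by have /andP[w0 w1] := wW k; rewrite lerXn2r ?nnegrE// (le_trans w0).
have Nd1 : 1 <= N%:R ^+ d :> R by rewrite exprn_ege1// ler1n.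
apply: le_trans (rademacher_sum _) _.
  move=> k; apply: le_trans (w2 k) _; apply: le_trans W1.
  by rewrite ler_peMl// sqr_ge0.
rewrite ler_wpM2l ?sqr_ge0//; apply: le_trans W2.
rewrite ler_expR ler_pM2l//.
apply: le_trans (ler_sum _ (fun k _ => w2 k)) _.
by rewrite sumr_const card_ffun !card_ord -[leLHS]mulr_natl natrX.
Qed.

Lemma Lnormy_le d' (T : measurableType d') (mu : {measure set T -> \bar R})
    (h : T -> R) (M : R) : 0 <= M -> (forall x, `|h x| <= M) ->
  ('N[mu]_+oo[EFin \o h] <= M%:E)%E.
Proof.
move=> M0 hM; rewrite unlock; case: ifPn => _; last by rewrite lee_fin.
by apply/ess_sup_inf.ess_supP/nearW => x /=; rewrite lee_fin.
Qed.

Lemma hard_alternatives (L M D rho : R) (e : E) : 0 < D -> 1 <= A -> 0 <= L ->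
  (forall z, (1 + z ^+ 2) ^+ s.+1 * sq_moment (@bump_poly R s) z <= D) ->
  gamma ^+ 2 * N%:R ^+ (2 * s) * (8 * D * A) ^+ d <= L ^+ 2 ->
  2 * (C / c) * H^-1 <= M ->
  rho < Num.sqrt (gamma ^+ 2 * (A * mass) ^+ d) ->
  alternatives r n m M s%:R L rho (f e, g e).
Proof.
move=> D0 A1 L0 decay small HM rho_lt.
have /andP[q0 q1] := cC_itv c0 rcC.
have Cc1 : 1 <= C / c by rewrite ler_pdivlMr// mul1r (le_cC rcC).
have H0 : 0 < H by rewrite exprn_gt0.
have H1 : 0 < H^-1 by rewrite invr_gt0.
have M0 : 0 <= M by apply: le_trans HM; rewrite mulr_ge0 ?(ltW H1)// mulr_ge0//
    (le_trans _ Cc1).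
have base_le x : base x <= H^-1 by exact: cube_fun_le.
have psi_le x : `|hard_psi e x| <= H^-1.
  apply: le_trans (hard_psi_le e x bB gB) _.
  by apply: le_trans (base_le x); rewrite ler_piMl// density_ge0.
split.
(* Both densities are at most [(C / c + 1) * H^-1], and [1 <= C / c] bounds this by
   [2 * (C / c) * H^-1]. *)
- have f_le x : `|f e x| <= M.
    rewrite ger0_norm; last exact: density_ge0.
    apply: (@le_trans _ _ (H^-1 + H^-1)).
      have -> : f e x = base x + weight_f * hard_psi e x by [].
      apply: lerD; first exact: base_le.
      apply: le_trans (ler_norm _) _; rewrite normrM.
      have /andP[w0 w1] := @weight_f_itv R n m n0.
      by rewrite ger0_norm//; apply: le_trans (psi_le x); rewrite ler_piMl.
    by apply: le_trans HM; nra.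
  have g_le x : `|g e x| <= M.
    rewrite ger0_norm; last exact: density_ge0.
    apply: (@le_trans _ _ (C / c * H^-1 + H^-1)).
      have -> : g e x = lam * r x * base x - weight_g * hard_psi e x by [].
      apply: lerD.
        apply: ler_pM; [exact/ltW/(lam_r_gt0 mr c0 rcC base x)|exact: density_ge0| |exact:
            base_le].
        exact: (lam_r_le mr c0 rcC base x).
      apply: le_trans (ler_norm _) _; rewrite normrN normrM.
      have /andP[w0 w1] := @weight_g_itv R n m n0.
      by rewrite ger0_norm//; apply: le_trans (psi_le x); rewrite ler_piMl.
    by apply: le_trans HM; nra.
  by rewrite ge_max; apply/andP; split; exact: Lnormy_le.
- by rewrite psi_perturbed// Lnorm2_hard_psi lte_fin.
- by rewrite psi_perturbed//; exact: hard_psi_sobolev decay small.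
Qed.

Lemma hard_separation (alpha beta t L M D : R) :
  0 < t -> beta < 1 - alpha - t ->
  N%:R ^+ d * W ^+ 2 <= 2^-1 -> expR (2 * (N%:R ^+ d * W ^+ 2)) <= 1 + t ^+ 2 ->
  0 < D -> 1 <= A -> 0 <= L ->
  (forall z, (1 + z ^+ 2) ^+ s.+1 * sq_moment (@bump_poly R s) z <= D) ->
  gamma ^+ 2 * N%:R ^+ (2 * s) * (8 * D * A) ^+ d <= L ^+ 2 ->
  2 * (C / c) * H^-1 <= M ->
  ((Num.sqrt (gamma ^+ 2 * (A * mass) ^+ d))%:E <=
    minimax_separation r n m M s%:R L alpha beta)%E.
Proof.
move=> t0 ab W1 W2 D0 A1 L0 decay small HM.
apply: le_ereal_inf_tmp => _ [rho' [rho0 inf_le]] <-.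
(* For a [rho'] below the norm of the perturbations every hard pair is an alternative, so each test
   of size [alpha] errs with probability at least [1 - alpha - t > beta] on one of them. *)
rewrite lee_fin leNgt; apply/negP => rho_lt.
move: inf_le; apply/negP; rewrite -ltNge.
apply: (@lt_le_trans _ _ (1 - alpha - t)%:E); first by rewrite lte_fin.
apply: le_ereal_inf_tmp => _ [phi [mphi phi01 size]] <-.
have phia : (\int[data_law base base' n m]_z (phi z)%:E <= alpha%:E)%E.
  apply: le_trans size; apply: ereal_sup_ubound.
  exists (base, base'); first exact: null_reweighted.
  by rewrite unlock.
have [e eP] := hard_second_moment t0 W1 W2 mphi phi01 phia.
apply: le_trans eP _; apply: ereal_sup_ubound.
exists (f e, g e); first exact: (hard_alternatives e D0 A1 L0 decay small HM rho_lt).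
by rewrite unlock.
Qed.

End second_moment.
End hard_family.

(** * Choice of the grid and of the constants *)

Lemma grid_size (R : realType) (n s d : nat) : (0 < n)%N -> (0 < d)%N ->
  exists N : nat, [/\ (0 < N)%N, (n%:R ^+ 2 : R) <= N%:R ^+ (4 * s + d) &
    (N%:R ^+ s : R) <= 2 ^+ s * n%:R `^ (2 * s%:R / (4 * s%:R + d%:R))].
Proof.
move=> n0 d0; pose q : R := 4 * s%:R + d%:R.
have q0 : 0 < q by rewrite ltr_wpDl ?ltr0n// mulr_ge0.
pose y : R := n%:R `^ (2 / q).
have n1 : 1 <= n%:R :> R by rewrite ler1n.
have y0 : 0 <= y by exact: powR_ge0.
have y1 : 1 <= y.
  by rewrite -(powRr0 n%:R) ler_powR// divr_ge0// ltW.
have /andP[yl yr] := truncn_itv y0.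
(* Exceeding [y] secures the lower bound on [N]; since [y >= 1], the extra 1 costs at most a factor
   2. *)
exists (Num.truncn y).+1; split => //.
- have yq : y ^+ (4 * s + d) = n%:R ^+ 2.
    rewrite -powR_mulrn// -powRrM natrD natrM -/q divfK ?gt_eqF//.
    by rewrite powR_mulrn.
  by rewrite -yq lerXn2r ?nnegrE// ltW.
- have -> : n%:R `^ (2 * s%:R / q) = y ^+ s.
    rewrite -powR_mulrn// -powRrM; congr (_ `^ _); ring.
  rewrite -exprMn lerXn2r ?nnegrE ?mulr_ge0//.
  by rewrite -natr1; lra.
Qed.

Theorem theorem10 (R : realType) (alpha beta c C tau M L : R) (d s : nat)
    (halpha : 0 < alpha < 1) (hbeta : 0 < beta < 1) (hab : alpha + beta < 1)
    (hc : 0 < c) (hcC : c <= C)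
    (hd : (0 < d)%N) (htau : 1 <= tau) (hM : 0 < M) (hs : (0 < s)%N)
    (hL : 0 < L) :
  exists c1 : R, 0 < c1 /\
    forall r : euclidean R d -> R, measurable_fun setT r ->
    (forall x, c <= r x <= C) ->
    forall n m : nat, (0 < n)%N -> (0 < m)%N -> (m <= n)%N ->
    n%:R <= tau * m%:R ->
    ((c1 * n%:R `^ (- (2 * s%:R / (4 * s%:R + d%:R))))%:E
      <= minimax_separation r n m M s%:R L alpha beta)%E.
Proof.
(* Half of the slack, so that [1 - alpha - t = beta + t]. *)
pose t := (1 - alpha - beta) / 2.
have t0 : 0 < t by rewrite divr_gt0//; lra.
have tab : beta < 1 - alpha - t by rewrite /t; lra.
have C0 : 0 < C by exact: lt_le_trans hcC.
have [B B0 bB] := @bump_bound R s.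
have [D D0 decay] := sq_moment_decay (@bump_poly_derivn0 R s).
have mass0 := @int_bump_poly_sqr_gt0 R s.
set mass := (\int[_]_(t in _) _) in mass0.
have Cc0 : 0 < C / c by rewrite divr_gt0.
(* The second term brings the height [A ^- d] of the uniform density below what [M] allows; the 1
   ensures [A >= 1], hence [A <= A ^ d]. *)
pose A := 1 + 2 * (C / c) / M.
have AM : 0 < 2 * (C / c) / M by rewrite divr_gt0// mulr_gt0.
have A1 : 1 <= A by rewrite lerDl ltW.
have A0 : 0 < A by exact: lt_le_trans A1.
have Ad0 : 0 < A ^+ d by rewrite exprn_gt0.
have HM : 2 * (C / c) * (A ^+ d)^-1 <= M.
  rewrite ler_pdivrMr// -ler_pdivrMl// mulrC.
  apply: (@le_trans _ _ A); first by rewrite lerDr.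
  by rewrite -[leLHS]expr1 ler_weXn2l.
pose G := (1 + C / c) * (A * A * mass) ^+ d.
have G0 : 0 < G by rewrite mulr_gt0 ?exprn_gt0 ?mulr_gt0// addr_gt0.
(* The two demands of the second moment bound on [N ^ d * W ^ 2], the second solved from
   [exp(2 Q) <= 1 + t ^ 2]. *)
pose Q := Num.min 2^-1 (ln (1 + t ^+ 2) / 2).
have Q0 : 0 < Q.
  by rewrite lt_min invr_gt0 ltr0n divr_gt0// ln_gt0// ltrDl exprn_gt0.
(* The last three bounds ensure that the perturbed densities are nonnegative, the Sobolev
   constraint, and the second moment bound. *)
pose g0 := Num.min 1 (Num.min (c / C * (A ^+ d)^-1 / B ^+ d)
  (Num.min (L ^+ 2 / (8 * D * A) ^+ d) (Q / G ^+ 2))).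
have P2 : 0 < (8 * D * A) ^+ d by rewrite exprn_gt0// !mulr_gt0.
have g00 : 0 < g0.
  rewrite !lt_min ltr01 /=; apply/and3P; split; apply: divr_gt0 => //; rewrite ?exprn_gt0//.
  by rewrite mulr_gt0 ?divr_gt0 ?invr_gt0.
(* This lets the bounds imposed on [g0] itself control [g0 ^ 2] and [g0 ^ 4]. *)
have g01 : g0 <= 1 by rewrite ge_min lexx.
have g0B : g0 * B ^+ d <= c / C * (A ^+ d)^-1.
  by rewrite -ler_pdivlMr ?exprn_gt0// !ge_min lexx orbT.
have g0L : g0 ^+ 2 * (8 * D * A) ^+ d <= L ^+ 2.
  rewrite -ler_pdivlMr//; apply: (@le_trans _ _ g0).
    by rewrite expr2 ler_piMr// ltW.
  by rewrite !ge_min lexx !orbT.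
have g0Q : g0 ^+ 4 * G ^+ 2 <= Q.
  rewrite -ler_pdivlMr ?exprn_gt0// (@le_trans _ _ g0)//.
    by rewrite exprS ler_piMr ?(ltW g00)// exprn_ile1// ltW.
  by rewrite !ge_min lexx !orbT.
have Am0 : 0 < (A * mass) ^+ d by rewrite exprn_gt0// mulr_gt0.
(* The norm of the perturbations is [gamma * sqrt((A * mass) ^ d)] with [gamma = g0 / N ^ s], and
   [grid_size] bounds [N ^ s] by [2 ^ s] times the rate. *)
exists (g0 * 2 ^- s * Num.sqrt ((A * mass) ^+ d)); split.
  by rewrite !mulr_gt0// ?sqrtr_gt0// invr_gt0 exprn_gt0.
move=> r mr rcC n m n0 m0 mn _.
have [N [N0 nN Nn]] := @grid_size R n s d n0 hd.
have NR0 : 0 < N%:R :> R by rewrite ltr0n.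
have NR1 : 1 <= N%:R :> R by rewrite ler1n.
pose gamma := g0 / N%:R ^+ s.
have Ns0 : 0 < N%:R ^+ s :> R by rewrite exprn_gt0.
have gamma0 : 0 < gamma by rewrite divr_gt0.
have gammaB : gamma * B ^+ d <= c / C * (A ^+ d)^-1.
  apply: le_trans g0B; rewrite ler_pM2r ?exprn_gt0//.
  by rewrite ler_pdivrMr// ler_peMr ?(ltW g00)// exprn_ege1.
have gammaN : gamma ^+ 2 * N%:R ^+ (2 * s) = g0 ^+ 2.
  by rewrite mulnC exprM -exprMn divfK// gt_eqF.
pose W := n%:R * (1 + C / c) * (gamma ^+ 2 * (A * (A / N%:R) * mass) ^+ d).
have WQ : N%:R ^+ d * W ^+ 2 <= Q.
  apply: le_trans g0Q.
  (* With [gamma = g0 / N ^ s] one has [W = n g0^2 G / N^(2 s + d)]; all dependence on the sample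
     size collects in one ratio, at most 1 by the choice of [N]. *)
  have -> : N%:R ^+ d * W ^+ 2 =
      n%:R ^+ 2 / N%:R ^+ (4 * s + d) * (g0 ^+ 4 * G ^+ 2).
    rewrite /W; have -> : gamma ^+ 2 * (A * (A / N%:R) * mass) ^+ d =
        g0 ^+ 2 * (A * A * mass) ^+ d / (N%:R ^+ s * N%:R ^+ s * N%:R ^+ d).
      rewrite (_ : A * (A / N%:R) * mass = A * A * mass / N%:R); last by field; rewrite gt_eqF.
      rewrite /gamma [(A * A * mass / _) ^+ d]exprMn exprVn.
      have Nd0 : N%:R ^+ d != 0 :> R by rewrite gt_eqF// exprn_gt0.
      move: (N%:R ^+ d) Nd0 (N%:R ^+ s) Ns0 ((A * A * mass) ^+ d) => x x0 y y0 z.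
      by field; rewrite x0 gt_eqF.
    rewrite /G exprD mulnC exprM.
    have Nd0 : N%:R ^+ d != 0 :> R by rewrite gt_eqF// exprn_gt0.
    move: (N%:R ^+ d) Nd0 (N%:R ^+ s) Ns0 ((A * A * mass) ^+ d) (n%:R) (1 + C / c) =>
        x x0 y y0 z u v.
    by field; rewrite x0 gt_eqF.
  by rewrite ler_piMl// ?ler_pdivrMr ?mul1r ?exprn_gt0// mulr_ge0// exprn_ge0// ltW.
apply: (@le_trans _ _ (Num.sqrt (gamma ^+ 2 * (A * mass) ^+ d))%:E).
  rewrite lee_fin sqrtrM ?sqr_ge0// sqrtr_sqr gtr0_norm//.
  rewrite mulrAC ler_pM2r ?sqrtr_gt0// /gamma.
  rewrite -[leLHS]mulrA ler_pM2l//.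
  rewrite powRN -invfM lef_pV2 ?posrE//.
  by rewrite mulr_gt0 ?exprn_gt0// powR_gt0// ltr0n.
apply: (hard_separation hd N0 A0 gamma0 mr hc rcC n0 m0 mn bB gammaB t0 tab _ _ D0 A1
    (ltW hL) decay _ HM).
- by apply: le_trans WQ _; rewrite ge_min lexx.
- rewrite -[leRHS]lnK ?posrE; last by rewrite addr_gt0// exprn_gt0.
  rewrite ler_expR mulrC -ler_pdivlMr//.
  by apply: le_trans WQ _; rewrite ge_min lexx orbT.
- by rewrite gammaN.
Qed.
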